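(* Let $X_1,X_2,\ldots$ be i.i.d. non-degenerate zero mean real random variables having a sub-exponential distribution with parameters $(\nu,b)$, where $\nu>0$, $b>0$. Assume that the distribution of $X_1$ is symmetric about zero. Then there are constants $C',c'>0$, depending only on the distribution of $X_1$, such that for every $n\ge1$, all $\alpha,\beta\in\mathbb{R}^n$ with $\alpha\neq 0$, and every $\gamma>0$, $$\mathbf{P}\{|\langle\alpha,X\rangle|\le|\langle\beta,X\rangle|\}\le C'\left\{\frac{\|\beta\|}{\|\alpha\|}+\frac{1}{\mathrm{LCD}_\gamma(\alpha/\|\alpha\|)}+e^{-c'\gamma^2}\right\}.$$
   Context: A zero mean random variable $Y$ has a sub-exponential distribution with parameters $(\nu,b)$, $\nu,b>0$, if $\mathbf{E}[e^{\lambda Y}]\le e^{\lambda^2\nu^2/2}$ for all $|\lambda|\le 1/b$. Non-degenerate means not almost surely constant. $X=(X_1,\ldots,X_n)$, $\langle\alpha,X\rangle=\sum_{i=1}^n\alpha_iX_i$, and $\|\cdot\|$ is the Euclidean norm. For $v\in\mathbb{R}^n$ and $\gamma>0$, the essential least common denominator is $$\mathrm{LCD}_\gamma(v)=\inf\left\{\theta>0:\ \mathrm{dist}(\theta v,\mathbb{Z}^n)\le\min\left\{\gamma,\tfrac{1}{10}\|\theta v\|\right\}\right\},$$ where $\mathrm{dist}$ is Euclidean distance. *)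

(* Defs.v *)
From HB Require Import structures.
From mathcomp Require Import all_boot all_order all_algebra finmap.
From mathcomp Require Import all_classical all_reals all_analysis.
Import Order.TTheory GRing.Theory Num.Theory.
Import numFieldNormedType.Exports.
Set Implicit Arguments.
Unset Strict Implicit.
Unset Printing Implicit Defensive.
Local Open Scope classical_set_scope.
Local Open Scope ring_scope.

(* The library norm on 'rV[R]_n is the sup norm, hence this definition. *)
Definition enorm (R : realType) (n : nat) (v : 'rV[R]_n) : R :=
  Num.sqrt (\sum_(i < n) v 0 i ^+ 2).

Definition dist_int (R : realType) (n : nat) (x : 'rV[R]_n) : R :=
  inf [set enorm (x - map_mx intr z) | z in [set: 'rV[int]_n]].

(* The set is nonempty for every v when gamma > 0 (Dirichlet's simultaneous
   approximation theorem) and bounded below by 0, so that the real-valued inf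
   is a genuine infimum. *)
Definition LCD (R : realType) (n : nat) (gamma : R) (v : 'rV[R]_n) : R :=
  inf [set theta : R | 0 < theta /\
    dist_int (theta *: v) <= Num.min gamma (10%:R^-1 * enorm (theta *: v))].

Section RandomVariables.
Context {d : measure_display} {T : measurableType d} {R : realType}.
Variable P : probability T R.

Definition mutually_independent (X : nat -> {RV P >-> R}) : Prop :=
  forall (J : {fset nat}) (A : nat -> set R),
    (forall i, measurable (A i)) ->
    P (\bigcap_(i in [set` J]) (X i @^-1` A i))
    = (\prod_(i <- J) P (X i @^-1` A i))%E.

Definition has_law (X : {RV P >-> R}) (mu : probability R R)
    : Prop :=
  forall A : set R, measurable A -> distribution P X A = mu A.

Definition same_law (X Y : {RV P >-> R}) : Prop :=
  forall A : set R, measurable A -> distribution P X A = distribution P Y A.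

Definition iid (X : nat -> {RV P >-> R}) : Prop :=
  mutually_independent X /\ forall i, same_law (X i) (X 0%N).

Definition zero_mean (X : {RV P >-> R}) : Prop :=
  P.-integrable [set: T] (EFin \o X) /\ ('E_P[X] = 0)%E.

Definition sub_exponential (nu b : R) (X : {RV P >-> R}) : Prop :=
  forall lambda : R, `|lambda| <= b^-1 ->
    ('M_P X lambda <= (expR (lambda ^+ 2 * nu ^+ 2 / 2%:R))%:E)%E.

Definition non_degenerate (X : {RV P >-> R}) : Prop :=
  ~ exists c : R, {ae P, forall w, X w = c}.

Definition symmetric_law (X : {RV P >-> R}) : Prop :=
  forall A : set R, measurable A ->
    P (X @^-1` A) = P ((fun w => - X w) @^-1` A).

(* Only the first n variables X 0, ..., X (n - 1) of the sequence are used. *)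
Definition inner_rv (n : nat) (a : 'rV[R]_n) (X : nat -> {RV P >-> R}) (w : T)
    : R :=
  \sum_(i < n) a 0 i * X i w.

End RandomVariables.

(* Main.v *)
Require Import Defs.
From HB Require Import structures.
From mathcomp Require Import all_boot all_order all_algebra finmap.
From mathcomp Require Import all_classical all_reals all_analysis.
From mathcomp Require Import measurable_realfun.
From mathcomp Require Import zify ring lra.
From mathcomp Require complex.
Import Order.TTheory GRing.Theory Num.Theory.
Import numFieldNormedType.Exports.
Local Open Scope classical_set_scope.
Local Open Scope ring_scope.
Set Implicit Arguments.
Unset Strict Implicit.
Unset Printing Implicit Defensive.

(** Divide alpha and beta by |alpha|.  Let v be the resulting unit vector, let
    t = |beta| / |alpha|, let D be any level below which no theta brings
    theta v close to the integer lattice, and let sigma be a fixed multiple of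
    t plus a fixed multiple of 1/D.  With A = <v, X> / sigma and
    B = <beta, X> / (|alpha| sigma) the event is {|A| <= |B|}, and the
    coefficients h of B satisfy |h| <= lam, where lam is a level at which
    X has exponential moments.

    Bounding P(|A| <= s) and P(|B| > s) separately loses a logarithm, because B
    has only exponential tails.  Instead the tail is absorbed pointwise: if K
    is the sum of two shifted Fejer kernels, then K(x) >= e^{-|x|}
    ([fejer_pair_ge1]), hence on the event 1 <= e^{|A|} K(A) <= (e^B + e^{-B}) K(A).
    As K is a trigonometric polynomial with frequencies in (-1, 1), the problem
    is reduced to the tilted characteristic functions E e^{+-B} cos(om A + phi).
    A discrete Fejer kernel is used, so that only finite sums over frequencies
    occur.

    The X_i are symmetric, so each of them may be multiplied by an independent
    sign.  For frozen |X_i|, the average over signs is the real part of a product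
    over i, whose factors have modulus sqrt(cosh(h_i x)^2 - sin(w_i x)^2)
    ([sign_sum_le], [normc_pair_sqr]).  This is at most
    1 + (h_i / lam)^2 e^{3 lam |x|} minus a multiple of sin(w_i x)^2 on
    the annulus {a <= |x| <= b} ([normc_pair_le_majorant]).  Independence turns
    the expectation of the product into the product of the expectations, which is
    at most exp(G - kappa p m) whenever the sum over i of sin(w_i x)^2 is at
    least m on the annulus ([integral_prod_majorant_le]); here p is the mass of
    the annulus, kappa the multiple above, and G bounds the exponential moment
    of order 3 lam of |X_i|.  The tilt costs only the
    constant factor e^G because the squares of the h_i sum to at most lam^2.

    Finally sin(pi y)^2 dominates the squared distance from y to the integers,
    and sigma is so large that, for each frequency om in (0, 1), the vector
    om x v / (pi sigma) is a multiple of v by a number below D; hence m is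
    the square of min(gamma, const om / sigma) ([sin_sum_ge]).  Averaging
    exp(- kappa p m) over om gives a term exp(- c gamma^2) and a Gaussian sum of
    size sigma ([sum_gaussian_min_le]).

    For D one takes the LCD.  Had no theta at all been an approximate
    denominator, the infimum defining the LCD would be the infimum of the empty
    set, with value 0; but then D can be taken arbitrarily large and the term
    1/D disappears ([LCD_le0]). *)

(** * Laws of random tuples *)

Definition box (R : Type) (n : nat) (A : 'I_n -> set R) : set (n.-tuple R) :=
  [set t | forall i, A i (tnth t i)].

Lemma measurable_box (R : realType) (n : nat) (A : 'I_n -> set R) :
  (forall i, measurable (A i)) -> measurable (box A).
Proof.
move=> mA.
have -> : box A = \big[setI/setT]_(i < n) ((@tnth n R ^~ i) @^-1` A i).
  by rewrite -bigcap_seq; apply/seteqP; split => t /= h i //;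
    [move=> _; exact: h|apply: h; rewrite /= mem_index_enum].
apply: bigsetI_measurable => i _.
by rewrite -[X in measurable X]setTI; exact: measurable_tnth.
Qed.

Lemma measurable_tuple_boxE (R : realType) (n : nat) :
  @measurable _ (n.-tuple R) =
  <<s [set E | exists2 A : 'I_n -> set R,
         (forall i, measurable (A i)) & E = box A] >>.
Proof.
apply/seteqP; split.
  apply: smallest_sub; first exact: smallest_sigma_algebra.
  rewrite -bigcup_seq => E [i _ [B mB <-]].
  apply: sub_sigma_algebra.
  exists (fun j => if j == i then B else setT).
    by move=> j; case: ifP.
  rewrite setTI; apply/seteqP; split => t /=.
    by move=> tB j; case: eqP => // ->.
  by move=> /(_ i); rewrite eqxx.
apply: smallest_sub; first exact: sigma_algebra_measurable.
by move=> _ [A mA ->]; exact: measurable_box.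
Qed.

(** Boxes form a pi-system generating the sigma-algebra. The two probability
    spaces may differ, which is what allows the comparison with a product space
    in [integral_redraw]. *)
Lemma tuple_law_unique (R : realType) (n : nat)
    (d d' : measure_display) (T : measurableType d) (T' : measurableType d')
    (P : probability T R) (P' : probability T' R)
    (U : {mfun T >-> n.-tuple R}) (V : {mfun T' >-> n.-tuple R}) :
  (forall A : 'I_n -> set R, (forall i, measurable (A i)) ->
     P (U @^-1` box A) = P' (V @^-1` box A)) ->
  forall E, measurable E -> distribution P U E = distribution P' V E.
Proof.
move=> UV E mE.
pose G := [set E | exists2 A : 'I_n -> set R,
         (forall i, measurable (A i)) & E = box A].
apply: (measure_unique G (fun=> setT)) => //.
- exact: measurable_tuple_boxE.
- move=> _ _ [A mA ->] [B mB ->]; exists (fun i => A i `&` B i).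
    by move=> i; exact: measurableI.
  apply/seteqP; split => t /=; first by move=> [h1 h2] i; split.
  by move=> h; split => i; have [] := h i.
- by move=> _; exists (fun=> setT) => //; apply/seteqP; split.
- by rewrite bigcup_const.
- by move=> _ [A mA ->]; exact: UV.
- by move=> _; rewrite ltey_eq fin_num_measure.
Qed.

Definition product_law (R : realType) (n : nat) (d : measure_display)
    (T : measurableType d) (P : probability T R) (mu : probability R R)
    (U : {mfun T >-> n.-tuple R}) : Prop :=
  forall A : 'I_n -> set R, (forall i, measurable (A i)) ->
    P (U @^-1` box A) = (\prod_(i < n) mu (A i))%E.

Section Tuple.
Context (R : realType) (n : nat) (d : measure_display) (T : measurableType d).
Context (P : probability T R) (mu : probability R R).
Implicit Type U : {mfun T >-> n.-tuple R}.

(** The pair consists of a fresh value for the coordinate [k] and of the point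
    that determines the other coordinates. *)
Definition redraw U (k : 'I_n) (z : R * T) : n.-tuple R :=
  [tuple if i == k then z.1 else tnth (U z.2) i | i < n].

Lemma measurable_redraw U k : measurable_fun setT (redraw U k).
Proof.
apply/measurable_fun_tnthP => i.
rewrite (_ : _ \o _ = if i == k then fst else (fun z => tnth (U z.2) i)); last first.
  by apply/funext => z /=; rewrite tnth_mktuple; case: eqP.
case: eqP => _; first exact: measurable_fst.
apply: (@measurableT_comp _ _ _ _ _ _ (fun x => tnth x i)).
  exact: measurable_tnth.
exact: measurableT_comp.
Qed.

HB.instance Definition _ U k :=
  isMeasurableFun.Build _ _ _ _ (redraw U k) (measurable_redraw U k).

Lemma redraw_law U k : product_law P mu U -> product_law (mu \x P)%E mu (redraw U k).
Proof.
move=> HU A mA.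
have -> : redraw U k @^-1` box A =
    A k `*` (U @^-1` box (fun i => if i == k then setT else A i)).
  apply/seteqP; split => -[x w] /=.
    move=> h; split; first by have := h k; rewrite tnth_mktuple eqxx.
    by move=> i; have := h i; rewrite tnth_mktuple; case: eqP.
  move=> [Ax h] i; rewrite tnth_mktuple /=; have := h i.
  by case: eqP => [->|].
have mB i : measurable (if i == k then setT else A i) by case: ifP.
have mUB : measurable (U @^-1` box (fun i => if i == k then setT else A i)).
  by rewrite -[X in measurable X]setTI; apply: measurable_funP => //; exact: measurable_box.
rewrite [LHS](@product_measure1E _ _ _ _ _ mu P)//.
transitivity (mu (A k) * \prod_(i < n) mu (if i == k then setT else A i))%E.
  by congr (_ * _)%E; exact: HU.
rewrite [RHS](bigD1 k)//= [in LHS](bigD1 k)//= eqxx probability_setT mul1e.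
by congr (_ * _)%E; apply: eq_bigr => i /negbTE ->.
Qed.

(** Redrawing one coordinate independently does not change the law, because
    both tuples give the same mass to boxes; Tonelli then separates the fresh
    coordinate. *)
Lemma integral_redraw U (k : 'I_n) (F : n.-tuple R -> \bar R) :
  product_law P mu U -> measurable_fun [set: n.-tuple R] F -> (forall t, 0 <= F t)%E ->
  (\int[P]_w F (U w) = \int[mu]_x \int[P]_w F (redraw U k (x, w)))%E.
Proof.
move=> HU mF F0.
rewrite -(@ge0_integral_distribution _ _ _ _ _ P U)//.
rewrite -(@fubini_tonelli1 _ _ _ _ _ mu P (fun z => F (redraw U k z)))//; last first.
  by apply: measurableT_comp => //; exact: measurable_redraw.
rewrite -(@ge0_integral_distribution _ _ _ _ _ (mu \x P)%E (redraw U k))//.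
apply: eq_measure_integral => A mA _.
apply: tuple_law_unique => // B mB.
by rewrite HU// redraw_law.
Qed.

(** Each redrawing step takes one factor out of the expectation. *)
Lemma integral_prod_law U (f : 'I_n -> R -> R) (s : seq 'I_n) :
  product_law P mu U -> uniq s ->
  (forall i, measurable_fun setT (f i)) -> (forall i x, 0 <= f i x) ->
  (\int[P]_w (\prod_(i <- s) f i (tnth (U w) i))%:E =
   \prod_(i <- s) \int[mu]_x (f i x)%:E)%E.
Proof.
move=> HU us mf f0.
have mF (s' : seq 'I_n) : measurable_fun setT
    (fun t : n.-tuple R => \prod_(i <- s') f i (tnth t i)).
  apply: measurable_prod => i _.
  by apply: measurableT_comp => //; exact: measurable_tnth.
have pF (s' : seq 'I_n) (t : n.-tuple R) : 0 <= \prod_(i <- s') f i (tnth t i).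
  by apply: prodr_ge0.
elim: s us => [|k s IH] /=.
  move=> _; under eq_integral do rewrite big_nil.
  by rewrite big_nil integral_cst// mul1e; exact: probability_setT.
move=> /andP[ks us]; rewrite big_cons -IH//.
rewrite (@integral_redraw U k (fun t => (\prod_(i <- k :: s) f i (tnth t i))%:E))//; first last.
- by move=> t; rewrite lee_fin.
- exact/measurable_EFinP.
rewrite -ge0_integralZr//; first last.
- by apply: integral_ge0 => w _; rewrite lee_fin.
- by move=> x _; rewrite lee_fin.
- exact/measurable_EFinP.
apply: eq_integral => x _; rewrite -ge0_integralZl//; first last.
- by rewrite lee_fin.
- by move=> w _; rewrite lee_fin.
- by apply/measurable_EFinP; exact: (measurableT_comp (mF s)).
apply: eq_integral => w _; rewrite big_cons tnth_mktuple eqxx EFinM/=; congr (_ * _%:E)%E.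
apply: eq_big_seq => i si; rewrite tnth_mktuple; case: eqP => // ik.
by rewrite -ik si in ks.
Qed.

Definition flip (e : {ffun 'I_n -> bool}) (t : n.-tuple R) : n.-tuple R :=
  [tuple (-1) ^+ e i * tnth t i | i < n].

Lemma measurable_flip e : measurable_fun setT (flip e).
Proof.
apply/measurable_fun_tnthP => i.
rewrite (_ : _ \o _ = fun t : n.-tuple R => (-1) ^+ e i * tnth t i); last first.
  by apply/funext => z /=; rewrite tnth_mktuple.
by apply: measurable_funM => //; exact: measurable_tnth.
Qed.

Lemma probability_flip U (e : {ffun _}) (E : set (n.-tuple R)) :
  product_law P mu U ->
  (forall A : set R, measurable A -> mu (-%R @^-1` A) = mu A) ->
  measurable E -> P (U @^-1` E) = P ((fun w => flip e (U w)) @^-1` E).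
Proof.
move=> HU sym mE.
have mV : measurable_fun setT (flip e \o U).
  by apply: measurableT_comp => //; exact: measurable_flip.
pose V : {mfun T >-> n.-tuple R} := HB.pack (flip e \o U)
  (isMeasurableFun.Build _ _ _ _ (flip e \o U) mV).
apply: (@tuple_law_unique _ _ _ _ _ _ P P U V) => // A mA.
have -> : V @^-1` box A = U @^-1` box (fun i => ( *%R ((-1) ^+ e i)) @^-1` A i).
  by apply/seteqP; split => w /= h i; have := h i; rewrite tnth_mktuple.
have mA' i : measurable (( *%R ((-1) ^+ e i)) @^-1` A i).
  by rewrite -[X in measurable X]setTI; apply: measurable_funM => //.
rewrite !HU//; apply: eq_bigr => i _.
case: (e i); last by congr (mu _); apply/funext => x /=; rewrite expr0 mul1r.
by rewrite -[LHS]sym//; congr (mu _); apply/funext => x /=; rewrite expr1 mulN1r.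
Qed.

End Tuple.

(** * What the hypotheses on the sequence say about the common law *)

Section FromRandomVariables.
Context (R : realType) (d : measure_display) (T : measurableType d).
Context (P : probability T R) (mu : probability R R).
Variable X : nat -> {RV P >-> R}.

Definition rv_tuple (n : nat) (w : T) : n.-tuple R := [tuple X i w | i < n].

Lemma measurable_rv_tuple n : measurable_fun setT (rv_tuple n).
Proof.
apply/measurable_fun_tnthP => i.
rewrite (_ : _ \o _ = X i)//.
by apply/funext => w /=; rewrite tnth_mktuple.
Qed.

HB.instance Definition _ n :=
  isMeasurableFun.Build _ _ _ _ (rv_tuple n) (@measurable_rv_tuple n).

Lemma iid_product_law n :
  iid X -> has_law (X 0%N) mu -> product_law P mu (rv_tuple n).
Proof.
move=> [indep same] law A mA.
pose B (i : nat) := if insub i is Some j then A j else setT.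
have mB i : measurable (B i) by rewrite /B; case: insubP.
have BE (i : 'I_n) : B i = A i by rewrite /B insubT//= => ?; congr A; exact: val_inj.
have := indep [fset nat_of_ord i | i in 'I_n]%fset B mB.
have -> : \bigcap_(i in [set` [fset nat_of_ord i | i in 'I_n]%fset]) X i @^-1` B i =
    rv_tuple n @^-1` box A.
  apply/seteqP; split => w /= h.
    move=> i; rewrite tnth_mktuple -BE; apply: h => /=.
    by apply/imfsetP; exists i.
  by move=> _ /imfsetP[i _ ->]; have := h i; rewrite tnth_mktuple -BE.
move=> ->.
rewrite big_imfset /=; last by move=> i j _ _; exact: val_inj.
rewrite big_enum/=; apply: eq_bigr => i _; by rewrite BE -law//; exact: same.
Qed.

Lemma symmetric_law_oppr : has_law (X 0%N) mu -> symmetric_law (X 0%N) ->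
  forall A : set R, measurable A -> mu (-%R @^-1` A) = mu A.
Proof.
move=> law sym A mA.
have mNA : measurable (-%R @^-1` A : set R).
  by rewrite -[X in measurable X]setTI; exact: oppr_measurable.
by rewrite -[LHS]law// -[RHS]law//; apply/esym; exact: sym.
Qed.

Definition annulus (a b : R) : set R := [set x | a <= `|x| <= b].

Lemma measurable_annulus a b : measurable (annulus a b).
Proof.
rewrite (_ : annulus a b = (@Num.norm _ R) @^-1` `[a, b]%classic); last first.
  by apply/seteqP; split => x; rewrite /annulus /= in_itv.
by rewrite -[X in measurable X]setTI; apply: (@normr_measurable R setT) => //.
Qed.

(** Otherwise all the annuli [1/k <= |x| <= k] would be null, and they cover
    the complement of 0: the variable would vanish almost surely. *)
Lemma annulus_charged : has_law (X 0%N) mu -> non_degenerate (X 0%N) ->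
  exists a b : R, [/\ 0 < a, 0 < b & (0 < mu (annulus a b))%E].
Proof.
move=> law nd; apply: contrapT => H; apply: nd; exists 0.
have A0 (k : nat) : P.-negligible (X 0%N @^-1` annulus k.+1%:R^-1 k.+1%:R).
  exists (X 0%N @^-1` annulus k.+1%:R^-1 k.+1%:R); split => //.
    by rewrite -[X in measurable X]setTI; apply: measurable_funP => //; exact: measurable_annulus.
  apply/eqP; rewrite eq_le measure_ge0 andbT leNgt; apply/negP => pos.
  apply: H; exists k.+1%:R^-1, k.+1%:R; split; rewrite ?invr_gt0//.
  by rewrite -law//; exact: measurable_annulus.
apply: negligibleS (negligible_bigcup A0) => w /= /eqP w0.
have x0 : 0 < `|X 0%N w| by rewrite normr_gt0.
pose k := Num.truncn (`|X 0%N w| + `|X 0%N w|^-1).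
have kx : `|X 0%N w| + `|X 0%N w|^-1 < k.+1%:R.
  by rewrite /k truncnS_gt.
exists k => //; rewrite /annulus/=; apply/andP; split; last first.
  by apply/ltW/(le_lt_trans _ kx); rewrite lerDl invr_ge0.
rewrite -[leRHS]invrK lef_pV2 ?posrE ?invr_gt0//.
by apply/ltW/(le_lt_trans _ kx); rewrite lerDr.
Qed.

Lemma ge0_integral_law (f : R -> \bar R) : has_law (X 0%N) mu ->
  measurable_fun setT f -> (forall x, 0 <= f x)%E ->
  (\int[mu]_x f x = \int[P]_w f (X 0%N w))%E.
Proof.
move=> law mf f0; rewrite -(ge0_integral_distribution (X 0%N))//.
by apply: eq_measure_integral => A mA _; apply/esym/law.
Qed.

Lemma exponential_moment (nu b : R) : 0 < b -> has_law (X 0%N) mu ->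
  sub_exponential nu b (X 0%N) ->
  (\int[mu]_x (expR (b^-1 * `|x|))%:E <=
     (2 * expR (b^-1 ^+ 2 * nu ^+ 2 / 2))%:E)%E.
Proof.
move=> b0 law sub.
have mE : forall c : R, measurable_fun [set: R] (fun x : R => (expR (c * x))%:E).
  move=> c; apply/measurable_EFinP; apply: (measurableT_comp (@measurable_expR R)).
  exact: measurable_funM.
have mEn : forall c : R, measurable_fun [set: R] (fun x : R => (expR (c * `|x|))%:E).
  move=> c; apply/measurable_EFinP; apply: (measurableT_comp (@measurable_expR R)).
  by apply: measurable_funM => //; exact: normr_measurable.
have bound (c : R) : `|c| <= b^-1 ->
    (\int[mu]_x (expR (c * x))%:E <= (expR (c ^+ 2 * nu ^+ 2 / 2))%:E)%E.
  move=> cb; apply: le_trans (sub c cb).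
  rewrite ge0_integral_law// /mmt_gen_fun unlock.
  by under eq_integral do rewrite mulrC.
apply: (@le_trans _ _ (\int[mu]_x ((expR (b^-1 * x))%:E + (expR (- b^-1 * x))%:E))%E).
  apply: ge0_le_integral => //.
  - exact: emeasurable_funD.
  - move=> x _; rewrite -EFinD lee_fin.
    have [x0|x0] := ger0P x.
      by rewrite lerDl expR_ge0.
    by rewrite mulrN -mulNr lerDr expR_ge0.
rewrite ge0_integralD//.
have bN : `|b^-1| <= b^-1 by rewrite ger0_norm// invr_ge0 ltW.
rewrite mulrDl mul1r EFinD; apply: leeD; first exact: bound.
by apply: le_trans (bound _ _) _; rewrite ?normrN ?sqrrN.
Qed.

End FromRandomVariables.

(** * Averages over random signs *)

Section SignAverage.
Import mathcomp.real_closed.complex.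
Context {R : realType}.
Implicit Types (u w x y h lam : R).

(** The exponential of the complex number [u + i w]. *)
Definition cexp u w : complex R := Complex (expR u * cos w) (expR u * sin w).

Lemma cexpD u w u' w' : cexp u w * cexp u' w' = cexp (u + u') (w + w').
Proof.
apply/eqP; rewrite eq_complex /cexp /= expRD sinD cosD.
by apply/andP; split; apply/eqP; ring.
Qed.

Lemma cexp_sum (I : Type) (s : seq I) (u w : I -> R) :
  \prod_(i <- s) cexp (u i) (w i) = cexp (\sum_(i <- s) u i) (\sum_(i <- s) w i).
Proof.
elim/big_rec3: _ => [|i a b c _ ->]; last by rewrite cexpD.
by rewrite /cexp cos0 sin0 expR0 mulr1 mulr0.
Qed.

Lemma normc_cexp0 w : Normc.normc (cexp 0 w) = 1.
Proof. by rewrite /cexp /= expR0 !mul1r cos2Dsin2 sqrtr1. Qed.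

Lemma norm_Re_le (z : complex R) : `|complex.Re z| <= Normc.normc z.
Proof.
case: z => a b /=; rewrite -sqrtr_sqr ler_wsqrtr// lerDl; exact: sqr_ge0.
Qed.

Definition sgn (b : bool) : R := (-1) ^+ b.

Lemma normc_prod (I : Type) (s : seq I) (F : I -> complex R) :
  Normc.normc (\prod_(i <- s) F i) = \prod_(i <- s) Normc.normc (F i).
Proof.
elim/big_rec2: _ => [|i a b _ IH]; first exact: Normc.normc1.
by rewrite Normc.normcM IH.
Qed.

(** The left-hand side is the modulus of the real part of the sum over signs of
    exp(i phi) times a product over the coordinates, and the sum over sign
    vectors of such products is the product of the sums over one sign. *)
Lemma sign_sum_le (n : nat) (u w : 'I_n -> R) (phi : R) :
  `|\sum_(e : {ffun 'I_n -> bool})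
      expR (\sum_i sgn (e i) * u i) * cos (phi + \sum_i sgn (e i) * w i)|
  <= \prod_i Normc.normc (cexp (u i) (w i) + cexp (- u i) (- w i)).
Proof.
pose F i b := cexp (sgn b * u i) (sgn b * w i).
have -> : \prod_i Normc.normc (cexp (u i) (w i) + cexp (- u i) (- w i)) =
    Normc.normc (cexp 0 phi * \sum_(e : {ffun 'I_n -> bool}) \prod_i F i (e i)).
  rewrite Normc.normcM normc_cexp0 mul1r -bigA_distr_bigA normc_prod.
  apply: eq_bigr => i _; by rewrite big_bool addrC /F /sgn expr0 expr1 !mul1r !mulN1r.
apply: le_trans (norm_Re_le _).
rewrite mulr_sumr raddf_sum /=.
rewrite le_eqVlt; apply/orP; left; apply/eqP; congr `|_|; apply: eq_bigr => e _.
by rewrite /F cexp_sum cexpD add0r.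
Qed.

(** The modulus of 2 (cosh u cos w + i sinh u sin w). *)
Lemma normc_pair_sqr u w :
  Normc.normc (cexp u w + cexp (- u) (- w)) =
  Num.sqrt ((expR u + expR (- u)) ^+ 2 - 4 * sin w ^+ 2).
Proof.
rewrite /cexp /= cosN sinN; congr Num.sqrt.
have e1 : expR u * expR (- u) = 1 by exact: expRxMexpNx_1.
transitivity ((expR u + expR (- u)) ^+ 2 * cos w ^+ 2 +
  ((expR u + expR (- u)) ^+ 2 - 4 * (expR u * expR (- u))) * sin w ^+ 2); first by ring.
by rewrite e1 cos2sin2; ring.
Qed.

(** The quantity 2 cosh y - 2 is the square of e^{y/2} - e^{-y/2}, and for
    nonnegative y this difference equals e^{y/2} (1 - e^{-y}) <= y e^{y/2}. *)
Lemma cosh_le_sqr y : expR y + expR (- y) <= 2 + y ^+ 2 * expR `|y|.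
Proof.
wlog y0 : y / 0 <= y.
  move=> H; have [/H//|/ltW yn] := leP 0 y.
  by have := H (- y); rewrite oppr_ge0 opprK sqrrN normrN addrC; apply.
rewrite ger0_norm//.
have e1 : expR (y / 2) * expR (- (y / 2)) = 1 by exact: expRxMexpNx_1.
have ey : expR y = expR (y / 2) ^+ 2 by rewrite expr2 -expRD -splitr.
have eN : expR (- y) = expR (- (y / 2)) ^+ 2.
  by rewrite expr2 -expRD -opprD -splitr.
have h1 : expR (- y) >= 1 - y by have := expR_ge1Dx (- y).
have h0 : expR (y / 2) >= expR (- (y / 2)).
  by rewrite ler_expR; lra.
have h2 : expR (y / 2) - expR (- (y / 2)) <= y * expR (y / 2).
  have : expR (- (y / 2)) = expR (- y) * expR (y / 2) by rewrite -expRD; congr expR; lra.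
  move=> ->; have := expR_gt0 (y / 2); nra.
suff : (expR (y / 2) - expR (- (y / 2))) ^+ 2 <= (y * expR (y / 2)) ^+ 2.
  by rewrite ey eN; nra.
by rewrite ler_sqr ?nnegrE//; lra.
Qed.

(** Bounds the modulus of cosh(h x) cos(w x) + i sinh(h x) sin(w x). The cost of
    the tilt is quadratic in h, so that it can be summed over the coordinates;
    the gain from the oscillation is kept only for x in the annulus, where
    cosh(h x) is at most e^{lam b}. *)
Definition tilted_majorant (lam a b h w x : R) : R :=
  1 + (h / lam) ^+ 2 * expR (3 * lam * `|x|) -
  expR (- (lam * b)) / 2 * (\1_(annulus a b) x * sin (w * x) ^+ 2).

(** With c = 2 cosh(h x) and s = sin(w x)^2, concavity of the square root gives
    sqrt(c^2 - 4 s) <= c - 2 s / c. Then c - 2 <= (h x)^2 e^{|h x|}, and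
    lam |x| <= e^{lam |x|} trades the factor x^2 for exponentials; this is where
    the exponent 3 lam |x| comes from. *)
Lemma normc_pair_le_majorant lam a b h w x : 0 < lam -> `|h| <= lam ->
  Normc.normc (cexp (h * x) (w * x) + cexp (- (h * x)) (- (w * x))) <=
  2 * tilted_majorant lam a b h w x.
Proof.
move=> l0 hl; rewrite normc_pair_sqr.
set c := (expR (h * x) + expR (- (h * x))).
set s := sin (w * x) ^+ 2.
have e1 : expR (h * x) * expR (- (h * x)) = 1 by exact: expRxMexpNx_1.
have c2 : 2 <= c.
  have := sqr_ge0 (expR (h * x) - expR (- (h * x))).
  have := expR_gt0 (h * x); have := expR_gt0 (- (h * x)).
  by rewrite /c; nra.
have s1 : 0 <= s <= 1.
  rewrite /s sqr_ge0 sin2cos2; have := sqr_ge0 (cos (w * x)); lra.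
have ci : c * c^-1 = 1 by rewrite divff//; lra.
have ci0 : 0 < c^-1 <= 2^-1.
  by rewrite invr_gt0 lef_pV2 ?posrE; lra.
set d := c^-1 in ci ci0.
have cs : Num.sqrt (c ^+ 2 - 4 * s) <= c - 2 * s * d.
  have q0 : 0 <= c - 2 * s * d by nra.
  rewrite -[leRHS]ger0_norm// -[leRHS]sqrtr_sqr ler_wsqrtr//.
  have -> : (c - 2 * s * d) ^+ 2 = c ^+ 2 - 4 * s * (c * d) + 4 * (s * d) ^+ 2 by ring.
  by rewrite ci; have := sqr_ge0 (s * d); lra.
apply: (le_trans cs); rewrite /tilted_majorant -/s.
have hlx : `|h * x| <= lam * `|x| by rewrite normrM ler_wpM2r.
have cup : c <= 2 + 2 * ((h / lam) ^+ 2 * expR (3 * lam * `|x|)).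
  apply: (le_trans (cosh_le_sqr _)); rewrite lerD2l.
  have lx : lam * `|x| <= expR (lam * `|x|).
    by apply: le_trans (expR_ge1Dx _); rewrite lerDr.
  have lx0 : 0 <= lam * `|x| by rewrite mulr_ge0// ltW.
  have -> : (h * x) ^+ 2 = (h / lam) ^+ 2 * (lam * `|x|) ^+ 2.
    rewrite exprMn -[x ^+ 2]real_normK ?num_real//.
    by field; rewrite gt_eqF.
  have E3 : expR (3 * lam * `|x|) = expR (lam * `|x|) ^+ 3.
    by rewrite -expRM_natl; congr expR; ring.
  have h0 := sqr_ge0 (h / lam).
  have el : expR `|h * x| <= expR (lam * `|x|) by rewrite ler_expR.
  rewrite E3 -mulrA.
  have : (lam * `|x|) ^+ 2 * expR `|h * x| <= expR (lam * `|x|) ^+ 3.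
    rewrite [leRHS]exprSr; apply: ler_pM => //; rewrite ?sqr_ge0 ?expR_ge0//.
    by rewrite ler_sqr// nnegrE expR_ge0.
  have e0 : 0 < expR (lam * `|x|) ^+ 3 by rewrite exprn_gt0// expR_gt0.
  move: (expR (lam * `|x|) ^+ 3) ((lam * `|x|) ^+ 2 * _) e0 => A B e0 AB.
  by nra.
have scale : expR (- (lam * b)) * (\1_(annulus a b) x * s) <= 2 * s * d.
  rewrite indicE; case: (boolP (x \in annulus a b)) => xA; last by rewrite mul0r mulr0; nra.
  rewrite mul1r /=.
  have xb : `|x| <= b by move: xA; rewrite inE => /andP[].
  have cE : c <= 2 * expR (lam * b).
    have hb : `|h * x| <= lam * b.
      by apply: le_trans hlx _; rewrite ler_wpM2l// ltW.
    move: hb; rewrite ler_norml => /andP[h1 h2].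
    have : expR (h * x) <= expR (lam * b) by rewrite ler_expR.
    have : expR (- (h * x)) <= expR (lam * b) by rewrite ler_expR; lra.
    by rewrite /c; lra.
  have : expR (- (lam * b)) <= 2 * d.
    have eE : expR (lam * b) * expR (- (lam * b)) = 1 by exact: expRxMexpNx_1.
    have m0 := expR_gt0 (- (lam * b)).
    have md : 0 <= expR (- (lam * b)) * d by rewrite mulr_ge0; lra.
    have := ler_wpM2l md cE; nra.
  by nra.
lra.
Qed.

End SignAverage.

(** * Elementary trigonometry and the Fejer kernel *)

Section Fejer.
Context {R : realType}.
Implicit Types (x y : R) (N : nat).

Lemma one_sub_cos_le x : 2 - 2 * cos x <= x ^+ 2.
Proof.
have [y ye] : exists y, sin (x / 2) = x / 2 * cos y.
  have d (c : R) : is_derive c (1:R) (@sin R) (cos c) by exact: is_derive_sin.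
  have [x0|x0|->] := ltgtP (x / 2) 0.
  - have [c _] := @MVT R sin cos (x / 2) 0 x0 (fun c _ => d c)
      (continuous_subspaceT (@continuous_sin R)).
    by rewrite sin0 !sub0r mulrN => /oppr_inj ->; exists c; rewrite mulrC.
  - have [c _] := @MVT R sin cos 0 (x / 2) x0 (fun c _ => d c)
      (continuous_subspaceT (@continuous_sin R)).
    by rewrite sin0 !subr0 => ->; exists c; rewrite mulrC.
  - by exists 0; rewrite sin0 mul0r.
have -> : cos x = 1 - 2 * sin (x / 2) ^+ 2.
  have {1}-> : x = (x / 2) *+ 2 by rewrite -mulr_natr; lra.
  by rewrite cos_mulr2n cos2sin2; ring.
have -> : x ^+ 2 = 4 * (x / 2) ^+ 2 by field.
have : sin (x / 2) ^+ 2 <= (x / 2) ^+ 2.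
  by rewrite ye exprMn ler_piMr ?sqr_ge0//.
lra.
Qed.

(** For positive x, write sin x = 2 sin(x/2) cos(x/2) and, by the mean value theorem,
    sin(x/2) = (x/2) cos c with 0 < c < x/2. Both cosines are at least
    cos(pi/4), whose square is 1/2. *)
Lemma sin_ge_half x : `|x| <= pi / 2 -> (x / 2) ^+ 2 <= sin x ^+ 2.
Proof.
wlog x0 : x / 0 < x.
  move=> H; have [xp|xn|<-] := ltgtP 0 x; first exact: H.
    move=> hx; have := H (- x); rewrite oppr_gt0 normrN sinN mulNr !sqrrN; exact.
  by rewrite mul0r expr0n/= sqr_ge0.
rewrite gtr0_norm// => xp.
pose t := x / 2.
have t0 : 0 < t by rewrite divr_gt0.
have tp : t <= pi / 4 by rewrite /t; lra.
have pi0 := @pi_gt0 R.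
have [c] := @MVT R sin cos 0 t t0 (fun c _ => is_derive_sin c)
      (continuous_subspaceT (@continuous_sin R)).
rewrite in_itv /= => /andP[c0 ct]; rewrite sin0 !subr0 => st.
have q0 : 0 < cos (pi / 4) :> R.
  by apply: cos_gt0_pihalf; lra.
have q2 : cos (pi / 4) ^+ 2 = 1 / 2 :> R.
  have := cos_pihalf R; have -> : pi / 2 = (pi / 4) *+ 2 :> R by rewrite -mulr_natr; lra.
  rewrite cos_mulr2n; lra.
have mono (s : R) : 0 <= s <= pi / 4 -> cos (pi / 4) <= cos s.
  move=> /andP[s0 s1]; move: s1; rewrite le_eqVlt => /orP[/eqP->//|s1].
  by apply/ltW; rewrite ltr_cos// in_itv/=; lra.
have c1 : cos (pi / 4) <= cos c by apply: mono; lra.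
have c2 : cos (pi / 4) <= cos t by apply: mono; lra.
have sx : sin x = 2 * (cos t * sin t).
  have -> : x = t *+ 2 by rewrite -mulr_natr /t; lra.
  by rewrite sin_mulr2n -mulr_natr mulrC.
have sge : x / 2 <= sin x.
  rewrite sx st -/t.
  have : cos (pi / 4) ^+ 2 <= cos t * cos c by rewrite expr2 ler_pM// ltW.
  by rewrite q2; nra.
by rewrite ler_sqr// nnegrE; lra.
Qed.

(** The squared modulus of the average of e^{i j x / N} over j < N: a Riemann sum
    for the usual Fejer kernel of the line. *)
Definition fejer N x : R :=
  N%:R ^- 2 * ((\sum_(j < N) cos (j%:R * (x / N%:R))) ^+ 2 +
               (\sum_(j < N) sin (j%:R * (x / N%:R))) ^+ 2).

Lemma fejer_ge0 N x : 0 <= fejer N x.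
Proof. by rewrite mulr_ge0 ?invr_ge0 ?addr_ge0 ?sqr_ge0. Qed.

(** Real and imaginary parts of the geometric sum
    (1 - e^{iy}) sum_j e^{ijy} = 1 - e^{iNy}. *)
Lemma dirichlet_telescope N y :
  (\sum_(j < N) cos (j%:R * y)) * (1 - cos y) +
  (\sum_(j < N) sin (j%:R * y)) * sin y = 1 - cos (N%:R * y) /\
  (\sum_(j < N) sin (j%:R * y)) * (1 - cos y) -
  (\sum_(j < N) cos (j%:R * y)) * sin y = - sin (N%:R * y).
Proof.
elim: N => [|N [IH1 IH2]].
  by rewrite !big_ord0 !mul0r cos0 sin0; split; ring.
rewrite !big_ord_recr /= -[N.+1]addn1 natrD !mulrDl mul1r cosD sinD.
split; lra.
Qed.

(** Taking squared moduli in the geometric sum,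
    |sum_j e^{ijy}|^2 (2 - 2 cos y) = 2 - 2 cos (N y), and 2 - 2 cos y <= y^2.
    The bound does not depend on N. *)
Lemma fejer_lower N x : (0 < N)%N -> 2 - 2 * cos x <= fejer N x * x ^+ 2.
Proof.
move=> N0; have N0' : (N%:R : R) != 0 by rewrite pnatr_eq0 -lt0n.
have [h1 h2] := dirichlet_telescope N (x / N%:R).
set C := \sum_(j < N) cos _ in h1 h2 *; set S := \sum_(j < N) sin _ in h1 h2 *.
have Nx : N%:R * (x / N%:R) = x by field.
rewrite Nx in h1 h2.
have -> : fejer N x * x ^+ 2 = (C ^+ 2 + S ^+ 2) * (x / N%:R) ^+ 2.
  by rewrite /fejer -/C -/S; field.
have E : (C ^+ 2 + S ^+ 2) * (2 - 2 * cos (x / N%:R)) = 2 - 2 * cos x.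
  have -> : 2 - 2 * cos x = (1 - cos x) ^+ 2 + (- sin x) ^+ 2.
    by rewrite sqrrN sin2cos2; ring.
  rewrite -h1 -h2; have := cos2Dsin2 (x / N%:R).
  move: (cos _) (sin _) => c s cs.
  transitivity ((C ^+ 2 + S ^+ 2) * ((1 - c) ^+ 2 + s ^+ 2)); last by ring.
  by have -> : s ^+ 2 = 1 - c ^+ 2; [lra | ring].
rewrite -E ler_wpM2l ?addr_ge0 ?sqr_ge0//; exact: one_sub_cos_le.
Qed.

Lemma fejer_expand N x :
  fejer N x = N%:R ^- 2 *
    \sum_(j < N) \sum_(l < N) cos ((j%:R - l%:R) * (x / N%:R)).
Proof.
rewrite /fejer; congr (_ * _); rewrite !expr2 !mulr_suml -big_split /=.
apply: eq_bigr => j _; rewrite !mulr_sumr -big_split /=; apply: eq_bigr => l _.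
by rewrite mulrBl cosB.
Qed.

(** The zeros of 1 - cos are avoided by the two shifts:
    (2 - 2 cos(x + pi/2)) + (2 - 2 cos(x - pi/2)) = 4, whereas both
    (x + pi/2)^2 and (x - pi/2)^2 are at most (|x| + 2)^2 <= 4 e^{|x|}. *)
Lemma fejer_pair_ge1 N x : (0 < N)%N ->
  1 <= expR `|x| * (fejer N (x + pi / 2) + fejer N (x - pi / 2)).
Proof.
move=> N0.
have h1 := fejer_lower (x + pi / 2) N0; have h2 := fejer_lower (x - pi / 2) N0.
rewrite cosDpihalf in h1; rewrite cosBpihalf in h2.
have f1 := fejer_ge0 N (x + pi / 2); have f2 := fejer_ge0 N (x - pi / 2).
have p1 := @pihalf_ge1 R; have p2 := @pihalf_lt2 R.
have x0 := normr_ge0 x.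
have xx : - `|x| <= x <= `|x| by rewrite -ler_norml.
have b1 : (x + pi / 2) ^+ 2 <= (`|x| + 2) ^+ 2.
  by rewrite -subr_ge0 subr_sqr mulr_ge0//; lra.
have b2 : (x - pi / 2) ^+ 2 <= (`|x| + 2) ^+ 2.
  by rewrite -subr_ge0 subr_sqr mulr_ge0//; lra.
have b3 : (`|x| + 2) ^+ 2 <= 4 * expR `|x|.
  have -> : expR `|x| = expR (`|x| / 2) ^+ 2 by rewrite expr2 -expRD -splitr.
  have := expR_ge1Dx (`|x| / 2); set e := expR _ => he.
  have -> : 4 * e ^+ 2 = (2 * e) ^+ 2 by ring.
  by rewrite ler_sqr ?nnegrE; lra.
have g1 := ler_wpM2l f1 b1; have g2 := ler_wpM2l f2 b2.
have g3 := ler_wpM2l (addr_ge0 f1 f2) b3.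
lra.
Qed.

End Fejer.

(** * Expectation of the majorants *)

Lemma lee_prod_fin (R : realType) (I : Type) (s : seq I) (F : I -> \bar R) (r : I -> R) :
  (forall i, 0 <= F i <= (r i)%:E)%E ->
  (\prod_(i <- s) F i <= (\prod_(i <- s) r i)%:E)%E.
Proof.
move=> Fr; suff /andP[] : (0 <= \prod_(i <- s) F i <= (\prod_(i <- s) r i)%:E)%E by [].
elim/big_rec2: _ => [|i x y _ /andP[y0 yx]]; first by rewrite lee_fin ler01 lexx.
have /andP[F0 FrI] := Fr i.
by rewrite mule_ge0//= EFinM lee_pmul.
Qed.

Section FactorIntegral.
Context {R : realType} (mu : probability R R).
Variables (lam a b p G : R).
Hypotheses (lam0 : 0 < lam) (b0 : 0 < b).
Hypothesis charge : (p%:E <= mu (annulus a b))%E.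
Hypothesis moment : (\int[mu]_x (expR (3 * lam * `|x|))%:E <= G%:E)%E.

Local Notation kappa := (expR (- (lam * b)) / 2).

(** Real-valued because the integrand lies between 0 and 1, see
    [oscillationE]. *)
Definition oscillation (w : R) : R :=
  fine (\int[mu]_x (\1_(annulus a b) x * sin (w * x) ^+ 2)%:E).

Lemma measurable_sin_sqr (w : R) : measurable_fun setT (fun x : R => sin (w * x) ^+ 2).
Proof.
apply: measurable_funX; apply: measurableT_comp; last exact: measurable_funM.
by apply: continuous_measurable_fun; exact: continuous_sin.
Qed.

Lemma measurable_annulus_sin (w : R) :
  measurable_fun setT (fun x : R => \1_(annulus a b) x * sin (w * x) ^+ 2).
Proof.
apply: measurable_funM; last exact: measurable_sin_sqr.
by apply: measurable_indic; exact: measurable_annulus.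
Qed.

Lemma measurable_exp_norm (c : R) : measurable_fun setT (fun x : R => expR (c * `|x|)).
Proof.
apply: (measurableT_comp (@measurable_expR R)).
by apply: measurable_funM => //; exact: normr_measurable.
Qed.

Lemma measurable_tilted_majorant (h w : R) : measurable_fun setT (tilted_majorant lam a b h w).
Proof.
rewrite /tilted_majorant; apply: measurable_funB.
  by apply: measurable_funD => //; apply: measurable_funM => //; exact: measurable_exp_norm.
by apply: measurable_funM => //; exact: measurable_annulus_sin.
Qed.

Lemma annulus_sin_le1 (w x : R) : 0 <= \1_(annulus a b) x * sin (w * x) ^+ 2 <= 1.
Proof.
rewrite indicE; have := sqr_ge0 (cos (w * x)); have := sqr_ge0 (sin (w * x)).
by rewrite cos2sin2; case: (_ \in _); rewrite ?mul1r ?mul0r; lra.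
Qed.

Lemma half_expRN_bounds : 0 < kappa <= 2^-1.
Proof.
have h : expR (- (lam * b)) <= 1 by rewrite expR_le1 oppr_le0 mulr_ge0// ltW.
by have := expR_gt0 (- (lam * b)); lra.
Qed.

Lemma tilted_majorant_ge0 (h w x : R) : 0 <= tilted_majorant lam a b h w x.
Proof.
rewrite /tilted_majorant; have := annulus_sin_le1 w x.
have : 0 <= (h / lam) ^+ 2 * expR (3 * lam * `|x|) by rewrite mulr_ge0 ?sqr_ge0 ?expR_ge0.
move: (\1_(_) x * _) => y; have := half_expRN_bounds.
by move: (kappa) => k; nra.
Qed.

Lemma oscillationE (w : R) :
  (\int[mu]_x (\1_(annulus a b) x * sin (w * x) ^+ 2)%:E = (oscillation w)%:E)%E.
Proof.
rewrite /oscillation fineK// ge0_fin_numE; last first.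
  by apply: integral_ge0 => x _; rewrite lee_fin; have /andP[] := annulus_sin_le1 w x.
apply: (@le_lt_trans _ _ (\int[mu]_x (cst 1 x))%E); last first.
  by rewrite integral_cst// mul1e (@le_lt_trans _ _ 1%E) ?probability_le1 ?ltry.
apply: ge0_le_integral => //.
- by move=> x _; rewrite lee_fin; have /andP[] := annulus_sin_le1 w x.
- by apply/measurable_EFinP; exact: measurable_annulus_sin.
- by move=> x _; rewrite lee_fin; have /andP[] := annulus_sin_le1 w x.
Qed.

(** The subtracted term has a finite integral, so it is moved to the other side,
    where all the integrands are nonnegative; then 1 + y <= e^y. *)
Lemma integral_majorant_le (h w : R) :
  (\int[mu]_x (tilted_majorant lam a b h w x)%:E <=
     (expR ((h / lam) ^+ 2 * G - kappa * oscillation w))%:E)%E.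
Proof.
have k0 : 0 <= kappa by have := half_expRN_bounds; lra.
have mo : measurable_fun [set: R] (fun x : R => (\1_(annulus a b) x * sin (w * x) ^+ 2)%:E).
  by apply/measurable_EFinP; exact: measurable_annulus_sin.
have me : measurable_fun [set: R] (fun x : R => (expR (3 * lam * `|x|))%:E).
  by apply/measurable_EFinP; exact: measurable_exp_norm.
have o0 (x : R) : (0 <= (\1_(annulus a b) x * sin (w * x) ^+ 2)%:E)%E.
  by rewrite lee_fin; have /andP[] := annulus_sin_le1 w x.
have e0 (x : R) : (0 <= (expR (3 * lam * `|x|))%:E)%E by rewrite lee_fin expR_ge0.
have split : (\int[mu]_x (tilted_majorant lam a b h w x)%:E + (kappa * oscillation w)%:E =
    1 + ((h / lam) ^+ 2)%:E * \int[mu]_x (expR (3 * lam * `|x|))%:E)%E.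
  rewrite EFinM -oscillationE -ge0_integralZl_EFin//.
  rewrite -ge0_integralD//; first last.
  - by apply: measurable_funeM.
  - by move=> x _; rewrite mule_ge0// lee_fin.
  - by apply/measurable_EFinP; exact: measurable_tilted_majorant.
  - by move=> x _; rewrite lee_fin tilted_majorant_ge0.
  rewrite -ge0_integralZl_EFin ?sqr_ge0//.
  have <- : (\int[mu]_x (cst 1 x) = 1)%E.
    by rewrite integral_cst// mul1e; exact: probability_setT.
  rewrite -ge0_integralD//; first last.
  - by apply: measurable_funeM.
  - by move=> x _; rewrite mule_ge0// lee_fin sqr_ge0.
  by apply: eq_integral => x _; rewrite -!EFinM -!EFinD /tilted_majorant; congr EFin; ring.
have up : (\int[mu]_x (tilted_majorant lam a b h w x)%:E + (kappa * oscillation w)%:E <=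
    (1 + (h / lam) ^+ 2 * G)%:E)%E.
  rewrite split EFinD; apply: leeD => //; rewrite [leRHS]EFinM.
  by apply: lee_wpmul2l => //; rewrite lee_fin sqr_ge0.
apply: (@le_trans _ _ (1 + (h / lam) ^+ 2 * G - kappa * oscillation w)%:E).
  by rewrite EFinB leeBrDr.
by rewrite lee_fin -addrA expR_ge1Dx.
Qed.

(** Under the integral sign the sum is at least m on the annulus, whose mass is
    at least p. *)
Lemma oscillation_sum (n : nat) (w : 'I_n -> R) (m : R) : 0 <= m ->
  (forall x, annulus a b x -> m <= \sum_i sin (w i * x) ^+ 2) ->
  m * p <= \sum_i oscillation (w i).
Proof.
move=> m0 hm.
rewrite -lee_fin -sumEFin.
under eq_bigr do rewrite -oscillationE.
rewrite -ge0_integral_sum//; first last.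
- by move=> i x _; rewrite lee_fin; have /andP[] := annulus_sin_le1 (w i) x.
- by move=> i; apply/measurable_EFinP; exact: measurable_annulus_sin.
apply: (@le_trans _ _ (\int[mu]_x (m * \1_(annulus a b) x)%:E)%E).
  under eq_integral do rewrite EFinM.
  rewrite ge0_integralZl_EFin//; first last.
  - by apply/measurable_EFinP; apply: measurable_indic; exact: measurable_annulus.
  rewrite integral_indic ?setIT//; last exact: measurable_annulus.
  by rewrite [leLHS]EFinM; apply: lee_wpmul2l => //; rewrite lee_fin.
apply: ge0_le_integral => //.
- by move=> x _; rewrite lee_fin mulr_ge0// indicE.
- apply/measurable_EFinP; apply: measurable_funM => //.
  by apply: measurable_indic; exact: measurable_annulus.
- apply: emeasurable_sum => i; apply/measurable_EFinP; exact: measurable_annulus_sin.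
- move=> x _; rewrite sumEFin lee_fin -mulr_sumr mulrC indicE.
  by case: (boolP (x \in annulus a b)) => xA; rewrite ?mul0r// !mul1r hm// -in_setE.
Qed.

(** Multiplying the bounds of [integral_majorant_le], the exponents add up: the
    tilts contribute at most G, as the squares of the h_i / lam sum to at
    most 1, and the oscillations contribute at least m p. *)
Lemma integral_prod_majorant_le (n : nat) (d : measure_display) (T : measurableType d)
    (P : probability T R) (U : {mfun T >-> n.-tuple R}) (h w : 'I_n -> R) (m : R) :
  product_law P mu U -> 0 <= G -> 0 <= m ->
  \sum_i h i ^+ 2 <= lam ^+ 2 ->
  (forall x, annulus a b x -> m <= \sum_i sin (w i * x) ^+ 2) ->
  (\int[P]_t (\prod_i tilted_majorant lam a b (h i) (w i) (tnth (U t) i))%:E <=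
     (expR (G - kappa * p * m))%:E)%E.
Proof.
move=> HU G0 m0 hh hm.
rewrite (integral_prod_law (f := fun i => tilted_majorant lam a b (h i) (w i)) HU)//; first last.
- by move=> i x; exact: tilted_majorant_ge0.
- by move=> i; exact: measurable_tilted_majorant.
- exact: index_enum_uniq.
apply: (@le_trans _ _ (\prod_i (expR ((h i / lam) ^+ 2 * G - kappa * oscillation (w i))))%:E).
  apply: lee_prod_fin => i.
  rewrite integral_majorant_le andbT.
  by apply: integral_ge0 => x _; rewrite lee_fin tilted_majorant_ge0.
rewrite -expR_sum lee_fin ler_expR sumrB -mulr_suml -mulr_sumr.
have h1 := oscillation_sum m0 hm.
have h2 : \sum_i (h i / lam) ^+ 2 <= 1.
  under eq_bigr do rewrite exprMn.
  by rewrite -mulr_suml exprVn ler_pdivrMr ?exprn_gt0// mul1r.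
have k0 : 0 <= kappa by have := half_expRN_bounds; lra.
have h3 : (\sum_i (h i / lam) ^+ 2) * G <= G by rewrite ler_piMl.
have := ler_wpM2l k0 h1; lra.
Qed.

End FactorIntegral.

(** * From the event to tilted characteristic functions *)

Section SmallBall.
Context {R : realType}.

Lemma tilted_majorantN (lam a b h w x : R) :
  tilted_majorant lam a b (- h) w x = tilted_majorant lam a b h w x.
Proof. by rewrite /tilted_majorant mulNr sqrrN. Qed.

(** Expand the kernel into cosines of frequency (j - l) / N and apply
    [sign_sum_le] to each of them. *)
Lemma tilted_fejer_average (n N : nat) (lam a b phi : R) (h v : 'I_n -> R)
    (x : n.-tuple R) :
  0 < lam -> (forall i, `|h i| <= lam) ->
  \sum_(e : {ffun 'I_n -> bool})
     expR (\sum_i sgn (e i) * (h i * tnth x i)) *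
     fejer N (\sum_i sgn (e i) * (v i * tnth x i) + phi) <=
  2 ^+ n * (N%:R ^- 2 * \sum_(j < N) \sum_(l < N)
     \prod_i tilted_majorant lam a b (h i) ((j%:R - l%:R) / N%:R * v i) (tnth x i)).
Proof.
move=> lam0 hl.
under eq_bigr do rewrite fejer_expand mulrCA mulr_sumr.
rewrite -mulr_sumr mulrCA ler_wpM2l ?invr_ge0 ?exprn_ge0//.
rewrite exchange_big /= mulr_sumr; apply: ler_sum => j _.
under eq_bigr do rewrite mulr_sumr.
rewrite exchange_big /= mulr_sumr; apply: ler_sum => l _.
set om := (j%:R - l%:R) / N%:R.
have := sign_sum_le (fun i => h i * tnth x i) (fun i => om * v i * tnth x i) (om * phi).
move=> H; apply: (le_trans (le_trans _ H)).
  apply: le_trans (ler_norm _); rewrite le_eqVlt; apply/orP; left; apply/eqP.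
  apply: eq_bigr => e _; congr (_ * cos _).
  rewrite (_ : \sum_i sgn (e i) * (om * v i * tnth x i) =
    om * \sum_i sgn (e i) * (v i * tnth x i)); first by rewrite /om; ring.
  by rewrite mulr_sumr; apply: eq_bigr => i _; ring.
have -> : 2 ^+ n = \prod_(i < n) (2 : R) by rewrite prodr_const card_ord.
rewrite -big_split /=; apply: ler_prod => i _; apply/andP; split.
  exact: sqrtr_ge0.
exact: normc_pair_le_majorant.
Qed.

Definition dominated_event (n : nat) (sigma : R) (v h : 'I_n -> R) : set (n.-tuple R) :=
  [set t | `|\sum_i v i * tnth t i| <= sigma * `|\sum_i h i * tnth t i|].

Lemma measurable_dominated_event (n : nat) (sigma : R) (v h : 'I_n -> R) :
  measurable (dominated_event sigma v h).
Proof.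
have ml (g : 'I_n -> R) : measurable_fun [set: n.-tuple R]
    (fun t : n.-tuple R => `|\sum_i g i * tnth t i|).
  apply: (measurableT_comp (@normr_measurable R setT)).
  by apply: measurable_sum => i; apply: measurable_funM => //; exact: measurable_tnth.
rewrite -[X in measurable X]setTI.
have := measurable_fun_ler (ml v) (measurable_funM (measurable_cst sigma) (ml h)).
by move=> /(_ measurableT [set true]); apply.
Qed.

(** On the event, e^{|A|} <= e^{|B|} <= e^B + e^{-B}, where B is the form
    with coefficients h and A the form with coefficients v / sigma. The two signs of the tilt and the two shifts
    of the kernel produce the factor 4, since the majorant is even in h. *)
Lemma flip_average_le (n N : nat) (lam a b sigma : R) (h v : 'I_n -> R)
    (x : n.-tuple R) :
  (0 < N)%N -> 0 < lam -> 0 < sigma -> (forall i, `|h i| <= lam) ->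
  \sum_(e : {ffun 'I_n -> bool})
     \1_(dominated_event sigma v h) (flip e x) <=
  2 ^+ n * (4 * (N%:R ^- 2 * \sum_(j < N) \sum_(l < N)
     \prod_i tilted_majorant lam a b (h i) ((j%:R - l%:R) / N%:R * (v i / sigma)) (tnth x i))).
Proof.
move=> N0 lam0 s0 hl.
pose A e := \sum_i sgn (e i) * (v i / sigma * tnth x i) : R.
pose B (e : {ffun 'I_n -> bool}) := \sum_i sgn (e i) * (h i * tnth x i) : R.
pose B' (e : {ffun 'I_n -> bool}) := \sum_i sgn (e i) * (- h i * tnth x i) : R.
have B'E e : B' e = - B e.
  by rewrite /B /B' -sumrN; apply: eq_bigr => i _; ring.
have hl' i : `|- h i| <= lam by rewrite normrN.
have T phi := tilted_fejer_average N a b phi (fun i => v i / sigma) x lam0 hl.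
have T' phi := tilted_fejer_average N a b phi (fun i => v i / sigma) x lam0 hl'.
have step e :
   \1_(dominated_event sigma v h) (flip e x) <=
   (expR (B e) * fejer N (A e + pi / 2) + expR (B e) * fejer N (A e - pi / 2)) +
   (expR (B' e) * fejer N (A e + pi / 2) + expR (B' e) * fejer N (A e - pi / 2)).
  have f1 := fejer_ge0 N (A e + pi / 2); have f2 := fejer_ge0 N (A e - pi / 2).
  have e1 := expR_ge0 (B e); have e2 := expR_ge0 (B' e).
  rewrite indicE; case: (boolP (_ \in _)) => [/set_mem AB0|_]; last first.
    by do !apply: addr_ge0; apply: mulr_ge0.
  rewrite /dominated_event /= in AB0.
  have AE : A e = (\sum_i v i * tnth (flip e x) i) / sigma.
    rewrite /A mulr_suml; apply: eq_bigr => i _; rewrite tnth_mktuple /sgn.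
    by field; rewrite gt_eqF.
  have BE : B e = \sum_i h i * tnth (flip e x) i.
    by apply: eq_bigr => i _; rewrite tnth_mktuple /sgn; ring.
  have AB : `|A e| <= `|B e|.
    by rewrite AE BE normrM normfV (gtr0_norm s0) ler_pdivrMr// mulrC.
  have h1 := fejer_pair_ge1 (A e) N0.
  have h2 : expR `|A e| <= expR (B e) + expR (B' e).
    rewrite B'E; apply: (@le_trans _ _ (expR `|B e|)); first by rewrite ler_expR.
    have [_|_] := ger0P (B e); rewrite ?lerDl ?lerDr ?expR_ge0//.
  have := ler_wpM2r (addr_ge0 f1 f2) h2; rewrite mulr1n; lra.
apply: le_trans (ler_sum _ (fun e _ => step e)) _.
rewrite !big_split /=.
have T1 := T (pi / 2); have T2 := T (- (pi / 2)).
have T3 := T' (pi / 2); have T4 := T' (- (pi / 2)).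
have PN (w : 'I_n -> R) : \prod_i tilted_majorant lam a b (- h i) (w i) (tnth x i) =
   \prod_i tilted_majorant lam a b (h i) (w i) (tnth x i).
  by apply: eq_bigr => i _; rewrite tilted_majorantN.
have SN : \sum_(j < N) \sum_(l < N)
     \prod_i tilted_majorant lam a b (- h i) ((j%:R - l%:R) / N%:R * (v i / sigma)) (tnth x i) =
   \sum_(j < N) \sum_(l < N)
     \prod_i tilted_majorant lam a b (h i) ((j%:R - l%:R) / N%:R * (v i / sigma)) (tnth x i).
  by apply: eq_bigr => j _; apply: eq_bigr => l _; exact: PN.
rewrite {}SN in T3 T4.
move: T1 T2 T3 T4; rewrite -/A -/B -/B'; lra.
Qed.

(** By symmetry all the flipped events have the probability of the original one;
    hence this probability is the expectation of the average over flips. *)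
Lemma flip_average_prob (n : nat) (d : measure_display) (T : measurableType d)
    (P : probability T R) (mu : probability R R) (U : {mfun T >-> n.-tuple R})
    (E : set (n.-tuple R)) (F : n.-tuple R -> R) :
  product_law P mu U ->
  (forall A : set R, measurable A -> mu (-%R @^-1` A) = mu A) ->
  measurable E -> measurable_fun [set: n.-tuple R] F ->
  (forall x, \sum_(e : {ffun 'I_n -> bool}) \1_E (flip e x) <= 2 ^+ n * F x) ->
  (P (U @^-1` E) <= \int[P]_w (F (U w))%:E)%E.
Proof.
move=> HU sym mE mF EF.
have mUe (e : {ffun 'I_n -> bool}) : measurable_fun setT (fun w => \1_E (flip e (U w)) : R).
  apply: (measurableT_comp (measurable_indic mE)).
  by apply: measurableT_comp => //; exact: measurable_flip.
have p2 : (0 < (2 ^+ n : R)%:E)%E by rewrite lte_fin exprn_gt0.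
rewrite -(lee_pmul2l _ p2)//.
have F0 x : 0 <= F x.
  rewrite -(pmulr_rge0 _ (exprn_gt0 n (ltr0Sn R 1))); apply: le_trans (EF x).
  by apply: sumr_ge0 => e _; rewrite indicE.
rewrite -ge0_integralZl_EFin//; first last.
- by apply/measurable_EFinP; exact: measurableT_comp.
- by move=> w _; rewrite lee_fin.
have -> : ((2 ^+ n)%:E * P (U @^-1` E) =
   \sum_(e : {ffun 'I_n -> bool}) \int[P]_w (\1_E (flip e (U w)))%:E)%E.
  transitivity (\sum_(e : {ffun 'I_n -> bool}) P (U @^-1` E))%E.
    rewrite -(@fineK _ (P (U @^-1` E))) ?fin_num_measure//; last first.
      by rewrite -[X in measurable X]setTI; exact: measurable_funP.
    by rewrite sumEFin sumr_const card_ffun card_bool card_ord -[X in _ = X%:E]mulr_natl natrX -EFinM.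
  apply: eq_bigr => e _; rewrite (probability_flip e HU sym mE).
  have mV : measurable ((fun w => flip e (U w)) @^-1` E).
    rewrite -[X in measurable X]setTI; apply: (measurableT_comp (measurable_flip e)) => //.
  by rewrite -[X in P X]setIT -integral_indic.
rewrite -ge0_integral_sum//; first last.
- by move=> e; apply/measurable_EFinP; exact: mUe.
apply: ge0_le_integral => //.
- by move=> w _; apply: sume_ge0 => e _; rewrite lee_fin indicE.
- by apply: emeasurable_sum => e; apply/measurable_EFinP; exact: mUe.
- by apply: measurable_funeM; apply/measurable_EFinP; exact: measurableT_comp.
- by move=> w _; rewrite sumEFin -EFinM lee_fin.
Qed.

(** One of the two truncated differences is 0, so this is |j - l|. *)
Definition gap (j l : nat) : nat := (j - l + (l - j))%N.

Lemma sum_gap_le (N : nat) (g : nat -> R) (j : 'I_N) : (forall k, 0 <= g k) ->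
  \sum_(l < N) g (gap j l) <= 2 * \sum_(k < N) g k.
Proof.
move=> g0; have jN : (j <= N)%N by rewrite ltnW.
have sub (m1 m2 : nat) : (m1 <= m2)%N -> (m2 <= N)%N ->
    \sum_(m1 <= k < m2) g k <= \sum_(k < N) g k.
  move=> h1 h2; rewrite -(big_mkord xpredT g) (@big_cat_nat _ _ _ m1 0 N)//=; last exact: leq_trans h2.
  rewrite (@big_cat_nat _ _ _ m2 m1 N)//= addrCA lerDl addr_ge0//; exact: sumr_ge0.
rewrite -(big_mkord xpredT (fun l => g (gap j l))) (@big_cat_nat _ _ _ j 0 N)//= mulrDl mul1r.
apply: lerD.
  rewrite big_nat_rev /=.
  apply: le_trans (sub 1%N j.+1 _ _) => //.
  rewrite big_add1 /=; rewrite le_eqVlt; apply/orP; left; apply/eqP.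
  by apply: eq_big_nat => l lj; congr g; rewrite /gap; lia.
apply: le_trans (sub 0%N (N - j)%N _ _) => //; last exact: leq_subr.
rewrite -{1}[nat_of_ord j]add0n big_addn le_eqVlt; apply/orP; left; apply/eqP.
by apply: eq_big_nat => l lj; congr g; rewrite /gap; lia.
Qed.

(** Take the expectation in [flip_average_le]. Only the absolute value of the
    frequency matters, and each value of the gap is attained at most twice for
    given j; this turns the double sum into a single one. *)
Lemma dominated_prob_le (n N : nat) (lam a b p G sigma : R)
    (d : measure_display) (T : measurableType d)
    (P : probability T R) (mu : probability R R) (U : {mfun T >-> n.-tuple R})
    (h v : 'I_n -> R) (m : nat -> R) :
  product_law P mu U ->
  (forall A : set R, measurable A -> mu (-%R @^-1` A) = mu A) ->
  0 < lam -> 0 < b -> 0 < sigma -> (0 < N)%N ->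
  (p%:E <= mu (annulus a b))%E ->
  (\int[mu]_x (expR (3 * lam * `|x|))%:E <= G%:E)%E -> 0 <= G ->
  \sum_i h i ^+ 2 <= lam ^+ 2 ->
  (forall k, 0 <= m k) ->
  (forall k x, (k < N)%N -> annulus a b x ->
     m k <= \sum_i sin (k%:R / N%:R / sigma * v i * x) ^+ 2) ->
  (P (U @^-1` dominated_event sigma v h) <=
   (8 / N%:R * \sum_(k < N) expR (G - expR (- (lam * b)) / 2 * p * m k))%:E)%E.
Proof.
move=> HU sym lam0 b0 s0 N0 charge moment G0 hh m0 hm.
have hl i : `|h i| <= lam.
  rewrite -ler_sqr ?nnegrE ?(ltW lam0)// real_normK ?num_real//.
  by apply: le_trans hh; rewrite (bigD1 i)//= lerDl sumr_ge0// => j _; exact: sqr_ge0.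
pose w (j l : 'I_N) i := (j%:R - l%:R) / N%:R * (v i / sigma).
pose F (x : n.-tuple R) := 4 * (N%:R ^- 2 * \sum_(j < N) \sum_(l < N)
     \prod_i tilted_majorant lam a b (h i) (w j l i) (tnth x i)).
have mpr (j l : 'I_N) : measurable_fun [set: n.-tuple R] (fun x : n.-tuple R =>
    \prod_i tilted_majorant lam a b (h i) (w j l i) (tnth x i)).
  apply: measurable_prod => i _.
  by apply: measurableT_comp; [exact: measurable_tilted_majorant | exact: measurable_tnth].
have mF : measurable_fun [set: n.-tuple R] F.
  do 2!(apply: measurable_funM => //).
  by apply: measurable_sum => j; apply: measurable_sum => l.
apply: le_trans (flip_average_prob HU sym (measurable_dominated_event _ _ _) mF _) _.
  by move=> x; exact: flip_average_le.
have pr0 (j l : 'I_N) x : 0 <= \prod_i tilted_majorant lam a b (h i) (w j l i) (tnth x i).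
  by apply: prodr_ge0 => i _; exact: tilted_majorant_ge0.
have mI (j l : 'I_N) : measurable_fun setT (fun t =>
    (\prod_i tilted_majorant lam a b (h i) (w j l i) (tnth (U t) i))%:E).
  by apply/measurable_EFinP; exact: (measurableT_comp (mpr j l)).
pose g k := expR (G - expR (- (lam * b)) / 2 * p * m k).
have bound (j l : 'I_N) :
    (\int[P]_t (\prod_i tilted_majorant lam a b (h i) (w j l i) (tnth (U t) i))%:E
    <= (g (gap j l))%:E)%E.
  apply: (integral_prod_majorant_le lam0 b0 charge moment HU) => // x xA.
  have kN : (gap j l < N)%N by rewrite /gap; have := ltn_ord j; have := ltn_ord l; lia.
  apply: le_trans (hm _ x kN xA) _.
  apply: ler_sum => i _; rewrite /w.
  have [jl|lj] := leqP j l.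
    have -> : (gap j l)%:R = l%:R - j%:R :> R.
      by rewrite -natrB//; congr _%:R; rewrite /gap; lia.
    rewrite (_ : (l%:R - j%:R) / N%:R / sigma * v i * x =
      - ((j%:R - l%:R) / N%:R * (v i / sigma) * x)); last by ring.
    by rewrite sinN sqrrN.
  have -> : (gap j l)%:R = j%:R - l%:R :> R.
    by rewrite -natrB ?(ltnW lj)//; congr _%:R; rewrite /gap; lia.
  by rewrite (_ : (j%:R - l%:R) / N%:R / sigma * v i * x =
      (j%:R - l%:R) / N%:R * (v i / sigma) * x)//; ring.
have FE : (\int[P]_t (F (U t))%:E = (4 * N%:R ^- 2)%:E *
    \sum_(j < N) \sum_(l < N)
      \int[P]_t (\prod_i tilted_majorant lam a b (h i) (w j l i) (tnth (U t) i))%:E)%E.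
  have -> : (\sum_(j < N) \sum_(l < N)
      \int[P]_t (\prod_i tilted_majorant lam a b (h i) (w j l i) (tnth (U t) i))%:E =
    \int[P]_t \sum_(j < N) \sum_(l < N)
      (\prod_i tilted_majorant lam a b (h i) (w j l i) (tnth (U t) i))%:E)%E.
    rewrite ge0_integral_sum//; first last.
    - by move=> j t _; apply: sume_ge0 => l _; rewrite lee_fin.
    - by move=> j; apply: emeasurable_sum => l.
    by apply: eq_bigr => j _; rewrite ge0_integral_sum// => l t _; rewrite lee_fin.
  rewrite -ge0_integralZl_EFin//; first last.
  - by apply: emeasurable_sum => j; apply: emeasurable_sum => l.
  - by move=> t _; apply: sume_ge0 => j _; apply: sume_ge0 => l _; rewrite lee_fin.
  apply: eq_integral => t _.
  by under eq_bigr do rewrite sumEFin; rewrite sumEFin -EFinM /F mulrA.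
rewrite FE.
apply: (@le_trans _ _ ((4 * N%:R ^- 2)%:E * (\sum_(j < N) \sum_(l < N) g (gap j l))%:E)%E).
  apply: lee_wpmul2l; first by rewrite lee_fin mulr_ge0// invr_ge0 exprn_ge0.
  rewrite -sumEFin; apply: lee_sum => j _.
  by rewrite -sumEFin; apply: lee_sum => l _.
rewrite -EFinM lee_fin.
have g0 k : 0 <= g k by exact: expR_ge0.
have N0' : (N%:R : R) != 0 by rewrite pnatr_eq0 -lt0n.
apply: (@le_trans _ _ (4 * N%:R ^- 2 * \sum_(j < N) (2 * \sum_(k < N) g k))).
  rewrite ler_wpM2l//.
  by apply: ler_sum => j _; exact: sum_gap_le.
rewrite sumr_const card_ord -mulr_natl le_eqVlt; apply/orP; left; apply/eqP.
by rewrite -/g; field.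
Qed.

End SmallBall.

(** * Distance to the integer lattice and sums over frequencies *)

Section Lattice.
Context {R : realType}.

Lemma enorm_ge0 n (x : 'rV[R]_n) : 0 <= enorm x.
Proof. exact: sqrtr_ge0. Qed.

Lemma enorm_sqr n (x : 'rV[R]_n) : enorm x ^+ 2 = \sum_i x 0 i ^+ 2.
Proof. by rewrite sqr_sqrtr// sumr_ge0// => i _; exact: sqr_ge0. Qed.

Lemma enorm_gt0 n (x : 'rV[R]_n) : x != 0 -> 0 < enorm x.
Proof.
move=> x0; rewrite lt_neqAle enorm_ge0 andbT eq_sym; apply: contraNN x0 => /eqP xe.
have : enorm x ^+ 2 == 0 by rewrite xe expr0n.
rewrite enorm_sqr psumr_eq0; last by move=> i _; exact: sqr_ge0.
move=> /allP h; apply/eqP/rowP => i; rewrite mxE.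
by have := h i (mem_index_enum i); rewrite sqrf_eq0 => /eqP.
Qed.

Lemma enormZ n (c : R) (x : 'rV[R]_n) : enorm (c *: x) = `|c| * enorm x.
Proof.
rewrite /enorm -sqrtr_sqr -sqrtrM ?sqr_ge0// mulr_sumr; congr Num.sqrt.
by apply: eq_bigr => i _; rewrite mxE exprMn.
Qed.

Lemma coord_le_enorm n (x : 'rV[R]_n) i : `|x 0 i| <= enorm x.
Proof.
rewrite -ler_sqr ?nnegrE ?enorm_ge0// enorm_sqr real_normK ?num_real//.
by rewrite (bigD1 i)//= lerDl sumr_ge0// => j _; exact: sqr_ge0.
Qed.

Lemma dist_int_le n (x : 'rV[R]_n) (z : 'rV[int]_n) :
  dist_int x <= enorm (x - map_mx intr z).
Proof.
apply: ge_inf; last by exists z.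
by exists 0 => _ [y _ <-]; exact: enorm_ge0.
Qed.

Lemma dist_int_ge0 n (x : 'rV[R]_n) : 0 <= dist_int x.
Proof.
apply: lb_le_inf; first by exists (enorm (x - map_mx intr 0)); exists 0.
by move=> _ [y _ <-]; exact: enorm_ge0.
Qed.

(** If z is nonzero, one coordinate of theta v - z is at least 1 - theta in
    absolute value; if z = 0, the distance is theta. *)
Lemma dist_int_small n (v : 'rV[R]_n) (theta : R) :
  enorm v = 1 -> 0 < theta -> theta <= 2^-1 -> theta <= dist_int (theta *: v).
Proof.
move=> v1 t0 t2; apply: lb_le_inf.
  by exists (enorm (theta *: v - map_mx intr 0)); exists 0.
move=> _ [z _ <-].
have [->|/eqP/rowP z0] := eqVneq z 0.
  have -> : map_mx intr (0 : 'rV[int]_n) = 0 :> 'rV[R]_n.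
    by apply/rowP => i; rewrite !mxE.
  by rewrite subr0 enormZ v1 mulr1 gtr0_norm.
have [i zi] : exists i, z 0 i != 0.
  by apply: contrapT => h; apply: z0 => i; rewrite mxE; apply/eqP/negPn/negP => zi; apply: h; exists i.
apply: le_trans (coord_le_enorm _ i); rewrite !mxE.
have vi : `|theta * v 0 i| <= 2^-1.
  have := coord_le_enorm v i; rewrite v1 normrM gtr0_norm//.
  have := normr_ge0 (v 0 i); nra.
have z1 : 1 <= `|(z 0 i)%:~R : R|.
  by rewrite -intr_norm ler1z; lia.
have := lerB_dist ((z 0 i)%:~R : R) (theta * v 0 i); rewrite distrC; lra.
Qed.

Lemma sin_sqr_shift (x : R) (z : int) : sin (x - pi * z%:~R) ^+ 2 = sin x ^+ 2.
Proof.
have nat_shift (n : nat) (y : R) : sin (y + pi *+ n) ^+ 2 = sin y ^+ 2.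
  by rewrite (alternatingn (@sinDpi R)) exprMn sqrr_sign mul1r.
case: z => n.
  by rewrite -(nat_shift n (x - _)) -[pi *+ n]mulr_natr subrK.
rewrite NegzE -(nat_shift n.+1 x); congr (sin _ ^+ 2).
by rewrite mulrNz mulrN opprK -[pi *+ n.+1]mulr_natr.
Qed.

(** Compare with the nearest lattice point: sin^2 has period pi, and on
    [-pi/2, pi/2] it is at least (x/2)^2, where (pi/2)^2 >= 1. *)
Lemma dist_int_sin n (y : 'rV[R]_n) :
  dist_int y ^+ 2 <= \sum_i sin (pi * y 0 i) ^+ 2.
Proof.
pose z : 'rV[int]_n := \row_i Num.floor (y 0 i + 2^-1).
apply: (@le_trans _ _ (enorm (y - map_mx intr z) ^+ 2)).
  by rewrite ler_sqr ?nnegrE ?enorm_ge0 ?dist_int_ge0// dist_int_le.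
rewrite enorm_sqr; apply: ler_sum => i _; rewrite !mxE.
set k := Num.floor _.
have k1 : k%:~R <= y 0 i + 2^-1 by exact: ge_floor.
have k2 : y 0 i + 2^-1 < k%:~R + 1.
  by have := lt_succ_floor (y 0 i + 2^-1); rewrite intrD.
rewrite -(sin_sqr_shift _ k) -mulrBr.
have p2 := @pi_ge2 R.
set u := y 0 i - k%:~R.
have u1 : `|u| <= 2^-1 by rewrite ler_norml /u; lra.
have hu : `|pi * u| <= pi / 2 by rewrite normrM (gtr0_norm (pi_gt0 R)) ler_wpM2l// pi_ge0.
apply: le_trans (sin_ge_half hu).
have -> : (pi * u / 2) ^+ 2 = (pi / 2) ^+ 2 * u ^+ 2 by field.
by rewrite ler_peMl ?sqr_ge0// expr_ge1//; lra.
Qed.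

End Lattice.

Section GeometricSum.
Context {R : realType}.

Lemma sum_expR_le (eta : R) (N : nat) : 0 < eta ->
  \sum_(k < N) expR (- (eta * k%:R)) <= 1 + eta^-1.
Proof.
move=> e0; set q := expR (- eta).
have q0 : 0 < q by exact: expR_gt0.
have qe : q * expR eta = 1 by rewrite /q mulrC expRxMexpNx_1.
have ge := expR_ge1Dx eta.
have q1 : eta <= (1 + eta) * (1 - q) by nra.
have tel : (1 - q) * \sum_(k < N) expR (- (eta * k%:R)) = 1 - q ^+ N.
  rewrite -[1 - q ^+ N]opprB subrX1 -mulNr opprB; congr (_ * _); apply: eq_bigr => k _.
  by rewrite -expRM_natr mulNr.
have s0 : 0 <= \sum_(k < N) expR (- (eta * k%:R)).
  by apply: sumr_ge0 => k _; exact: expR_ge0.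
have qN : 0 <= q ^+ N by rewrite exprn_ge0// ltW.
have -> : 1 + eta^-1 = (1 + eta) / eta by field; rewrite gt_eqF.
rewrite ler_pdivlMr// mulrC.
apply: (@le_trans _ _ ((1 + eta) * (1 - q) * \sum_(k < N) expR (- (eta * k%:R)))).
  by rewrite ler_wpM2r.
by rewrite -mulrA tel; nra.
Qed.

(** When the minimum is gamma the term is exp(- c^2 gamma^2). Otherwise
    y^2 >= y - 1 replaces the Gaussian by the terms e^{1 - y} of a geometric
    series. *)
Lemma sum_gaussian_min_le (c gamma omega : R) (N : nat) : 0 < c -> 0 < omega -> (0 < N)%N ->
  \sum_(k < N) expR (- (c ^+ 2 * Num.min gamma (omega * k%:R) ^+ 2)) <=
  N%:R * expR (- (c ^+ 2 * gamma ^+ 2)) + expR 1 * (1 + (c * omega)^-1).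
Proof.
move=> c0 o0 N0.
apply: (@le_trans _ _ (\sum_(k < N) (expR (- (c ^+ 2 * gamma ^+ 2)) +
    expR 1 * expR (- (c * omega * k%:R))))); last first.
  rewrite big_split /= sumr_const card_ord mulr_natl lerD2l -mulr_sumr.
  by rewrite ler_wpM2l ?expR_ge0// sum_expR_le// mulr_gt0.
apply: ler_sum => k _; rewrite minEle; case: ifP => _.
  by rewrite lerDl mulr_ge0 ?expR_ge0.
rewrite -expRD; apply: (@le_trans _ _ (expR (1 + - (c * omega * k%:R)))); last first.
  by rewrite lerDr expR_ge0.
rewrite ler_expR.
have -> : c ^+ 2 * (omega * k%:R) ^+ 2 = (c * omega * k%:R) ^+ 2 by ring.
have := sqr_ge0 (c * omega * k%:R - 2^-1); set y := c * omega * _ => h.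
lra.
Qed.

End GeometricSum.

(** * The bound for a given level below the approximate denominators *)

Section Main.
Context {R : realType} (mu : probability R R).
Variables (lam a b p G : R).
Hypotheses (lam0 : 0 < lam) (a0 : 0 < a) (b0 : 0 < b) (p0 : 0 < p) (G0 : 0 <= G).
Hypothesis charge : (p%:E <= mu (annulus a b))%E.
Hypothesis moment : (\int[mu]_x (expR (3 * lam * `|x|))%:E <= G%:E)%E.
Hypothesis sym : forall A : set R, measurable A -> mu (-%R @^-1` A) = mu A.

Definition bound_rate : R := expR (- (lam * b)) / 2 * p.

Definition bound_constant : R :=
  8 * expR (G + 1) * (1 + (Num.sqrt bound_rate * (a / (10 * pi)))^-1) * (1 + lam^-1 + b).

(** The level [D] is arbitrary, and not the LCD itself, so as to cover the case
    in which no approximate denominator exists; see [LCD_le0]. *)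
Definition no_denominator (n : nat) (gamma D : R) (v : 'rV[R]_n) : Prop :=
  forall theta, 0 < theta -> theta < D ->
    Num.min gamma (10^-1 * enorm (theta *: v)) < dist_int (theta *: v).

Lemma bound_rate_gt0 : 0 < bound_rate.
Proof. by rewrite /bound_rate mulr_gt0// divr_gt0// expR_gt0. Qed.

(** By [dist_int_sin] the sum is at least the squared distance of theta v to the
    lattice, with theta = t |x| / (pi sigma). As |x| <= b and sigma >= b / D,
    this theta is below D, so the distance exceeds min(gamma, theta / 10); and
    theta >= t a / (pi sigma). *)
Lemma sin_sum_ge (n : nat) (v : 'rV[R]_n) (gamma D sigma x t : R) :
  enorm v = 1 -> 0 < gamma -> 0 < D -> no_denominator gamma D v ->
  0 < sigma -> b / D <= sigma -> 0 <= t < 1 -> annulus a b x ->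
  Num.min gamma (a / (10 * pi) * (t / sigma)) ^+ 2 <=
    \sum_i sin (t / sigma * v 0 i * x) ^+ 2.
Proof.
set omega := a / (10 * pi); move=> v1 g0 D0 nd s0 bD /andP[t0 t1] /andP[ax xb].
have pi2 := @pi_ge2 R.
have pi0 : pi != 0 :> R by rewrite gt_eqF// pi_gt0.
pose theta := t / sigma * `|x| / pi.
have -> : \sum_i sin (t / sigma * v 0 i * x) ^+ 2 =
    \sum_i sin (pi * (theta *: v) 0 i) ^+ 2.
  apply: eq_bigr => i _; rewrite mxE /theta.
  have -> : pi * (t / sigma * `|x| / pi * v 0 i) = t / sigma * v 0 i * `|x|.
    by rewrite mulrA [pi * _]mulrC divfK//; ring.
  by have [//|_] := ger0P x; rewrite mulrN sinN sqrrN.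
apply: le_trans (dist_int_sin _).
have [->|tn] := eqVneq t 0.
  by rewrite mul0r mulr0 min_r ?(ltW g0)// expr0n /= sqr_ge0.
have tp : 0 < t by rewrite lt_neqAle eq_sym tn.
have xp : 0 < `|x| := lt_le_trans a0 ax.
have th0 : 0 < theta by rewrite !mulr_gt0// invr_gt0// pi_gt0.
have thD : theta < D.
  have h1 : t / sigma * b <= t * D.
    by rewrite mulrAC ler_pdivrMr// -mulrA ler_wpM2l// mulrC -ler_pdivrMr.
  rewrite /theta ltr_pdivrMr ?pi_gt0//.
  have h2 : t / sigma * `|x| <= t / sigma * b by rewrite ler_wpM2l// divr_ge0// ltW.
  nra.
have := nd theta th0 thD; rewrite enormZ v1 mulr1 gtr0_norm// => hd.
have om0 : 0 <= omega * (t / sigma).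
  by rewrite mulr_ge0 ?divr_ge0 ?mulr_ge0 ?pi_ge0 ?ltW.
rewrite ler_sqr ?nnegrE ?dist_int_ge0//; last by rewrite le_min (ltW g0).
apply: le_trans (ltW hd); rewrite le_min ge_min lexx /= ge_min; apply/orP; right.
have -> : omega * (t / sigma) = 10^-1 * (t / sigma * a / pi).
  by rewrite /omega; move: pi pi0 => q q0; field; rewrite q0 gt_eqF.
by rewrite /theta ler_wpM2l// ler_wpM2r ?invr_ge0 ?pi_ge0// ler_wpM2l// divr_ge0// ltW.
Qed.

(** The number N of frequencies is at least 1 / sigma, so that the error 1 / N of
    the Riemann sum is absorbed by sigma. *)
Lemma inner_prob_le (d : measure_display) (T : measurableType d) (P : probability T R)
    (n : nat) (U : {mfun T >-> n.-tuple R}) (alpha beta : 'rV[R]_n) (gamma D : R) :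
  product_law P mu U -> alpha != 0 -> 0 < gamma -> 0 < D ->
  no_denominator gamma D ((enorm alpha)^-1 *: alpha) ->
  (P [set w | `|\sum_i alpha 0%R i * tnth (U w) i| <= `|\sum_i beta 0%R i * tnth (U w) i|]%R
   <= (bound_constant * (enorm beta / enorm alpha + D^-1 + expR (- bound_rate * gamma ^+ 2)))%:E)%E.
Proof.
move=> HU al0 g0 D0 nd.
pose c := Num.sqrt bound_rate; pose omega := a / (10 * pi).
have A0 := enorm_gt0 al0; set A := enorm alpha in A0 nd *.
set t := enorm beta / A.
have t0 : 0 <= t by rewrite divr_ge0 ?enorm_ge0// ltW.
(* The first summand makes the tilt admissible, |h| = t / sigma <= lam; the
   second one keeps the frequencies below D. *)
pose sigma := t / lam + b / D.
have bD0 : 0 < b / D by rewrite divr_gt0.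
have tl0 : 0 <= t / lam by rewrite divr_ge0// ltW.
have s0 : 0 < sigma by rewrite /sigma; lra.
pose v : 'rV[R]_n := A^-1 *: alpha.
have v1 : enorm v = 1 by rewrite enormZ gtr0_norm ?invr_gt0// mulVf// gt_eqF.
pose h i := beta 0 i / A / sigma.
pose N := (Num.truncn sigma^-1).+1.
have N0 : (0 < N)%N by [].
have Ns : sigma^-1 <= N%:R by apply/ltW; rewrite /N truncnS_gt.
have NR : 0 < N%:R :> R by rewrite ltr0n.
pose m k := Num.min gamma (omega * (k%:R / N%:R / sigma)) ^+ 2.
have hh : \sum_i h i ^+ 2 <= lam ^+ 2.
  have -> : \sum_i h i ^+ 2 = (t / sigma) ^+ 2.
    rewrite /t /h !exprMn enorm_sqr !mulr_suml.
    by apply: eq_bigr => i _; rewrite !exprMn.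
  have ts0 : 0 <= t / sigma by rewrite mulr_ge0// invr_ge0 ltW.
  rewrite ler_sqr ?nnegrE ?(ltW lam0)//.
  rewrite ler_pdivrMr// -ler_pdivrMl// mulrC /sigma lerDl.
  exact: ltW.
have := @dominated_prob_le R n N lam a b p G sigma d T P mu U h (fun i => v 0 i) m
  HU sym lam0 b0 s0 N0 charge moment G0 hh.
have -> : U @^-1` dominated_event sigma (fun i => v 0 i) h =
    [set w | `|\sum_i alpha 0 i * tnth (U w) i| <= `|\sum_i beta 0 i * tnth (U w) i|].
  apply/seteqP; rewrite /dominated_event.
  have E w : (`|\sum_i v 0 i * tnth (U w) i| <= sigma * `|\sum_i h i * tnth (U w) i|) =
      (`|\sum_i alpha 0 i * tnth (U w) i| <= `|\sum_i beta 0 i * tnth (U w) i|).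
    have -> : \sum_i v 0 i * tnth (U w) i = A^-1 * \sum_i alpha 0 i * tnth (U w) i.
      by rewrite mulr_sumr; apply: eq_bigr => i _; rewrite mxE mulrA.
    have -> : \sum_i h i * tnth (U w) i = A^-1 / sigma * \sum_i beta 0 i * tnth (U w) i.
      by rewrite mulr_sumr; apply: eq_bigr => i _; rewrite /h; field; rewrite !gt_eqF.
    rewrite !normrM !normfV (gtr0_norm A0) (gtr0_norm s0).
    rewrite (_ : sigma * _ = A^-1 * `|\sum_i beta 0 i * tnth (U w) i|); last first.
      by field; rewrite !gt_eqF.
    by rewrite ler_pM2l ?invr_gt0.
  by split => w /=; rewrite E.
move=> H; apply: le_trans (H _ _) _; first by move=> k; exact: sqr_ge0.
  move=> k x kN xA; apply: (@sin_sum_ge n v gamma D sigma x (k%:R / N%:R)) => //.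
    by rewrite /sigma lerDr.
  by rewrite divr_ge0//= ltr_pdivrMr// mul1r ltr_nat.
rewrite lee_fin.
have r0 := bound_rate_gt0.
have c0 : 0 < c by rewrite sqrtr_gt0.
have c2 : c ^+ 2 = bound_rate by rewrite sqr_sqrtr// ltW.
have om0 : 0 < omega by rewrite divr_gt0// mulr_gt0// pi_gt0.
have omN : 0 < omega / (N%:R * sigma) by rewrite divr_gt0// mulr_gt0.
have -> : \sum_(k < N) expR (G - expR (- (lam * b)) / 2 * p * m k) =
    expR G * \sum_(k < N) expR (- (c ^+ 2 * Num.min gamma (omega / (N%:R * sigma) * k%:R) ^+ 2)).
  rewrite mulr_sumr; apply: eq_bigr => k _; rewrite -expRD c2 /m /bound_rate.
  by congr (expR (_ - _ * Num.min _ _ ^+ 2)); field; rewrite !gt_eqF.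
have S := sum_gaussian_min_le gamma c0 omN N0.
set q := expR (- bound_rate * gamma ^+ 2).
have qE : expR (- (c ^+ 2 * gamma ^+ 2)) = q by rewrite c2 /q mulNr.
rewrite {}qE in S.
pose K := (c * omega)^-1.
have K0 : 0 < K by rewrite invr_gt0 mulr_gt0.
have KE : (c * (omega / (N%:R * sigma)))^-1 = N%:R * sigma * K.
  by rewrite /K; field; rewrite !gt_eqF.
rewrite {}KE in S.
have e1 : 0 < expR 1 :> R := expR_gt0 _.
have e1' : 1 <= expR 1 :> R by have := expR_ge1Dx (1 : R); lra.
have eG := expR_gt0 G.
have N1 : 1 <= N%:R * sigma.
  by rewrite -ler_pdivrMr// div1r.
have S1 : 8 / N%:R * (expR G * (N%:R * q + expR 1 * (1 + N%:R * sigma * K))) <=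
   8 * expR G * (q + expR 1 * (1 + K) * sigma).
  have -> : 8 * expR G * (q + expR 1 * (1 + K) * sigma) =
     8 / N%:R * (expR G * (N%:R * q + expR 1 * (N%:R * sigma + N%:R * sigma * K))).
    by field; rewrite gt_eqF.
  rewrite ler_wpM2l ?divr_ge0// ler_wpM2l ?(ltW eG)// lerD2l ler_wpM2l ?(ltW e1)//.
  by rewrite lerD2r.
apply: (@le_trans _ _ (8 * expR G * (q + expR 1 * (1 + K) * sigma))).
  apply: le_trans S1; rewrite ler_wpM2l ?divr_ge0// ler_wpM2l ?(ltW eG)//.
rewrite /bound_constant -/c -/omega -/K expRD.
have q0 : 0 <= q by exact: expR_ge0.
have Di : 0 < D^-1 by rewrite invr_gt0.
have li : 0 < lam^-1 by rewrite invr_gt0.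
have -> : 8 * (expR G * expR 1) * (1 + K) * (1 + lam^-1 + b) * (t + D^-1 + q) =
  8 * expR G * (expR 1 * (1 + K) * ((1 + lam^-1 + b) * (t + D^-1 + q))) by ring.
rewrite ler_wpM2l ?mulr_ge0 ?(ltW eG)//.
have M1 : 1 <= expR 1 * (1 + K) by nra.
have M2 : q + expR 1 * (1 + K) * sigma <= expR 1 * (1 + K) * (q + sigma) by nra.
apply: (le_trans M2); rewrite ler_wpM2l//; first lra.
have h1 : 0 <= t * b by rewrite mulr_ge0// ltW.
have h2 : 0 <= lam^-1 * D^-1 by rewrite mulr_ge0// ltW.
have h3 : 0 <= (lam^-1 + b) * q by rewrite mulr_ge0// addr_ge0// ltW.
by rewrite /sigma; lra.
Qed.

End Main.

(** * The least common denominator and the theorem *)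

Section LeastCommonDenominator.
Context {R : realType}.

Lemma no_denominator_LCD (n : nat) (gamma : R) (v : 'rV[R]_n) :
  no_denominator gamma (LCD gamma v) v.
Proof.
move=> theta t0 tD; rewrite ltNge; apply/negP => td; move: tD; rewrite ltNge.
by move=> /negP; apply; apply: ge_inf => //; exists 0 => x [/ltW].
Qed.

(** By [dist_int_small] every approximate denominator of a unit vector is at
    least 1/2; so a nonpositive LCD means that there is none, and that the LCD
    is the conventional infimum 0 of the empty set. *)
Lemma LCD_le0 (n : nat) (gamma : R) (v : 'rV[R]_n) :
  enorm v = 1 -> LCD gamma v <= 0 ->
  LCD gamma v = 0 /\ forall D, no_denominator gamma D v.
Proof.
move=> v1; rewrite /LCD; set S := [set _ | _] => S0.
have Se : S = set0.
  apply: contrapT => /eqP/set0P Sn.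
  have : 2^-1 <= inf S.
    apply: lb_le_inf => // theta [t0 td]; rewrite leNgt; apply/negP => t2.
    have := dist_int_small v1 t0 (ltW t2).
    move: td; rewrite le_min => /andP[_]; rewrite enormZ v1 mulr1 gtr0_norm//; lra.
  lra.
split=> [|D theta t0 _]; first by rewrite Se inf0.
rewrite ltNge; apply/negP => td.
by have : S theta by []; rewrite Se.
Qed.

End LeastCommonDenominator.

(** The quantities from which the constants of the theorem are computed. *)
Definition admissible (R : realType) (mu : probability R R) (lam a b p G : R) : Prop :=
  [/\ 0 < lam, 0 < a, 0 < b, 0 < p & 0 <= G] /\
  [/\ (p%:E <= mu (annulus a b))%E,
      (\int[mu]_x (expR (3 * lam * `|x|))%:E <= G%:E)%E &
      forall A : set R, measurable A -> mu (-%R @^-1` A) = mu A].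

(** The constants of the theorem are fixed by the law before the sequence is
    given. This shows that suitable parameters can be chosen whenever some
    sequence satisfies the hypotheses. *)
Lemma exists_admissible (R : realType) (mu : probability R R) (d : measure_display)
    (T : measurableType d) (P : probability T R) (X : nat -> {RV P >-> R}) (nu b : R) :
  0 < b -> has_law (X 0%N) mu -> non_degenerate (X 0%N) ->
  sub_exponential nu b (X 0%N) -> symmetric_law (X 0%N) ->
  exists t : R * R * R * R * R,
    admissible mu t.1.1.1.1 t.1.1.1.2 t.1.1.2 t.1.2 t.2.
Proof.
move=> b0 law nd sub sym.
have [r [s [r0 s0 charge]]] := annulus_charged law nd.
exists (b^-1 / 3, r, s, fine (mu (annulus r s)),
  2 * expR (b^-1 ^+ 2 * nu ^+ 2 / 2)) => /=.
have mA := @measurable_annulus R r s.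
split; split => //.
- by rewrite divr_gt0// invr_gt0.
- by rewrite fine_gt0// charge ltey_eq fin_num_measure.
- by rewrite fineK// fin_num_measure.
- have -> : 3 * (b^-1 / 3) = b^-1 by field; rewrite gt_eqF.
  exact: exponential_moment law sub.
- exact: symmetric_law_oppr law sym.
Qed.

Theorem theorem7 (R : realType) (mu : probability R R) :
  exists C' c' : R, 0 < C' /\ 0 < c' /\
  forall (d : measure_display) (T : measurableType d) (P : probability T R)
    (X : nat -> {RV P >-> R}) (nu b : R),
    0 < nu -> 0 < b ->
    iid X ->
    has_law (X 0%N) mu ->
    non_degenerate (X 0%N) ->
    zero_mean (X 0%N) ->
    sub_exponential nu b (X 0%N) ->
    symmetric_law (X 0%N) ->
  forall (n : nat) (alpha beta : 'rV[R]_n) (gamma : R),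
    (1 <= n)%N -> alpha != 0 -> 0 < gamma ->
    (P [set w | (`|inner_rv alpha X w| <= `|inner_rv beta X w|)%R]
     <= (C' * (enorm beta / enorm alpha
               + (LCD gamma ((enorm alpha)^-1 *: alpha))^-1
               + expR (- c' * gamma ^+ 2)))%:E)%E.
Proof.
have [[[[[[lam a] s] p] G] /= adm]|none] := pselect (exists t : R * R * R * R * R,
    admissible mu t.1.1.1.1 t.1.1.1.2 t.1.1.2 t.1.2 t.2); last first.
  (* A law without admissible parameters is not the law of any sequence
     satisfying the hypotheses. *)
  exists 1, 1; split => //; split => // d T P X nu b _ b0 _ law nd _ sub sym.
  by case: none; exact: exists_admissible law nd sub sym.
have [[lam0 a0 s0 p0 G0] [charge moment sym]] := adm.
exists (bound_constant lam a s p G), (bound_rate lam s p).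
have r0 : 0 < bound_rate lam s p by exact: bound_rate_gt0.
have C0 : 0 < bound_constant lam a s p G.
  have c1 : 0 <= Num.sqrt (bound_rate lam s p) * (a / (10 * pi)).
    by rewrite mulr_ge0 ?sqrtr_ge0// divr_ge0 ?(ltW a0)// mulr_ge0// pi_ge0.
  have c2 : 0 < 1 + (Num.sqrt (bound_rate lam s p) * (a / (10 * pi)))^-1.
    by rewrite ltr_wpDr// invr_ge0.
  have c3 : 0 < 1 + lam^-1 + s by rewrite !addr_gt0// invr_gt0.
  by rewrite /bound_constant; do 2!(apply: mulr_gt0 => //); rewrite mulr_gt0// expR_gt0.
split => //; split => // d T P X nu b _ _ ii law _ _ _ _ n alpha beta gamma _ al0 g0.
have HU := iid_product_law (n := n) ii law.
set D := LCD _ _.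
pose B := enorm beta / enorm alpha.
pose q := expR (- bound_rate lam s p * gamma ^+ 2).
have bound (D' : R) : 0 < D' ->
    no_denominator gamma D' ((enorm alpha)^-1 *: alpha) ->
    (P [set w | (`|inner_rv alpha X w| <= `|inner_rv beta X w|)%R]
     <= (bound_constant lam a s p G * (B + D'^-1 + q))%:E)%E.
  move=> D0 nD.
  have innerE (g : 'rV[R]_n) w :
      \sum_i g 0 i * tnth (rv_tuple X n w) i = inner_rv g X w.
    by apply: eq_bigr => i _; rewrite tnth_mktuple.
  have := inner_prob_le lam0 a0 s0 p0 G0 charge moment sym beta HU al0 g0 D0 nD.
  apply: le_trans; rewrite le_eqVlt; apply/orP; left; apply/eqP; congr (P _).
  by apply/seteqP; split => w /=; rewrite !innerE.
have [D0|Dle] := ltP 0 D; first exact: (bound D D0 (@no_denominator_LCD _ _ _ _)).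
have v1 : enorm ((enorm alpha)^-1 *: alpha) = 1.
  by rewrite enormZ gtr0_norm ?invr_gt0 ?enorm_gt0// mulVf// gt_eqF// enorm_gt0.
have [DE nD] := LCD_le0 v1 Dle.
rewrite /D DE invr0 addr0.
(* Every D' is allowed, and D' = C' / e makes the term C' / D' equal to e. *)
apply/lee_addgt0Pr => e e0; rewrite -EFinD.
have D'0 : 0 < bound_constant lam a s p G / e by rewrite divr_gt0.
apply: le_trans (bound _ D'0 (nD _)) _.
rewrite lee_fin invf_div -/B -/q le_eqVlt; apply/orP; left; apply/eqP.
by field; rewrite !gt_eqF.
Qed.
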